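(* Let $g=\theta\circ\lambda:\mathbf{S}^n\to(-\infty,\infty]$ be a spectral function (with $\theta(x)=g(\mathrm{Diag}(x))$) that is locally Lipschitz continuous relative to its domain, lower semicontinuous and convex. Let $\mu_1>\dots>\mu_r$ be the distinct eigenvalues of $X$. (a) If $Y\in\partial g(X)$ and $\theta$ is parabolically regular at $\lambda(X)$ for $\lambda(Y)$ and parabolically epi-differentiable at $\lambda(X)$, then $g$ is parabolically regular at $X$ for $Y$, and for every $H\in K_g(X,Y)$ and every $U\in\mathbf{O}^n(X)\cap\mathbf{O}^n(Y)$, $$\mathrm{d}^2g(X,Y)(H)=\mathrm{d}^2\theta(\lambda(X),\lambda(Y))(\lambda'(X;H))+2\sum_{m=1}^r\big\langle\Lambda(Y)_{\alpha_m\alpha_m},U_{\alpha_m}^\top H(\mu_mI-X)^\dagger HU_{\alpha_m}\big\rangle.$$ (b) If $g$ is parabolically epi-differentiable and parabolically regular at $X$, then $\theta$ is parabolically regular at $\lambda(X)$.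
   Context: $\mathbf{S}^n$: real symmetric matrices with trace inner product. $\lambda(X)$: eigenvalues in nonincreasing order; $\mathbf{O}^n(X)=\{U\text{ orthogonal}:X=U\mathrm{Diag}(\lambda(X))U^\top\}$. $\alpha_m=\{i:\lambda_i(X)=\mu_m\}$; $U_{\alpha_m}$: columns of $U$ indexed by $\alpha_m$; $\Lambda(Y)=\mathrm{Diag}(\lambda(Y))$, $\Lambda(Y)_{\alpha_m\alpha_m}$ its principal submatrix on $\alpha_m$; $Z^\dagger$: Moore–Penrose inverse. $\partial$: convex subdifferential. $\lambda'(X;H)=\lim_{t\downarrow0}(\lambda(X+tH)-\lambda(X))/t$. Locally Lipschitz relative to domain: around each point of $\mathrm{dom}\,g$, $|g(A)-g(B)|\le\ell\|A-B\|$ for $A,B$ in a neighborhood intersected with $\mathrm{dom}\,g$. Subderivative $\mathrm{d}f(\bar x)(\bar w)=\liminf_{t\downarrow0,w\to\bar w}\frac{f(\bar x+tw)-f(\bar x)}{t}$; critical cone $K_f(\bar x,\bar v)=\{w:\mathrm{d}f(\bar x)(w)=\langle\bar v,w\rangle\}$; parabolic subderivative $\mathrm{d}^2f(\bar x)(w|z)=\liminf_{t\downarrow0,z'\to z}\frac{f(\bar x+tw+\frac12t^2z')-f(\bar x)-t\mathrm{d}f(\bar x)(w)}{\frac12t^2}$ (for $\mathrm{d}f(\bar x)(w)$ finite); $f$ is parabolically epi-differentiable at $\bar x$ if for each $w$ with $\mathrm{d}f(\bar x)(w)$ finite, $\{z:\mathrm{d}^2f(\bar x)(w|z)<\infty\}\neq\emptyset$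 and for every $z$ and $t_k\downarrow0$ there is $z_k\to z$ with the difference quotients $\frac{f(\bar x+t_kw+\frac12t_k^2z_k)-f(\bar x)-t_k\mathrm{d}f(\bar x)(w)}{\frac12t_k^2}\to\mathrm{d}^2f(\bar x)(w|z)$. Second subderivative $\mathrm{d}^2f(\bar x,\bar v)(w)=\liminf_{t\downarrow0,w'\to w}\Delta^2_tf(\bar x,\bar v)(w')$ with $\Delta^2_tf(\bar x,\bar v)(w)=\frac{f(\bar x+tw)-f(\bar x)-t\langle\bar v,w\rangle}{\frac12t^2}$. A convex $f$ is parabolically regular at $\bar x$ for $\bar v\in\partial f(\bar x)$ if for every $w$ with $\mathrm{d}^2f(\bar x,\bar v)(w)<\infty$, among sequences $t_k\downarrow0,w_k\to w$ with $\Delta^2_{t_k}f(\bar x,\bar v)(w_k)\to\mathrm{d}^2f(\bar x,\bar v)(w)$ there are ones with $\limsup_k\|w_k-w\|/t_k<\infty$; parabolically regular at $\bar x$ if so for every $\bar v\in\partial f(\bar x)$. *)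

(* Defs.v *)
From HB Require Import structures.
From mathcomp Require Import all_boot all_order all_algebra.
From mathcomp Require Import all_classical all_reals.
From mathcomp Require Import ereal topology normedtype sequences.
Import numFieldNormedType.Exports.
Set Implicit Arguments. Unset Strict Implicit. Unset Printing Implicit Defensive.
Import Order.TTheory GRing.Theory Num.Theory.
Local Open Scope classical_set_scope.
Local Open Scope ring_scope.

Section Defs.
Variable R : realType.

Definition inner {p q : nat} (A B : 'M[R]_(p, q)) : R := \tr (A^T *m B).
Definition nrm {p q : nat} (A : 'M[R]_(p, q)) : R := Num.sqrt (inner A A).

Definition symm {n : nat} : set 'M[R]_n := [set A | A^T = A].
Definition orthogonal {n : nat} (U : 'M[R]_n) : Prop := U^T *m U = 1%:M.

Definition nonincreasing {n : nat} (x : 'rV[R]_n) : Prop :=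
  forall i j : 'I_n, (i <= j)%N -> x ord0 j <= x ord0 i.

(* lambda(X): the vector of eigenvalues of X in nonincreasing order, i.e. the
   (unique, for symmetric X) nonincreasing x with X = U Diag(x) U^T, U orthogonal *)
Definition lam {n : nat} (X : 'M[R]_n) : 'rV[R]_n :=
  xget 0 [set x | nonincreasing x /\
                  exists U : 'M[R]_n, orthogonal U /\ X = U *m diag_mx x *m U^T].

Definition On {n : nat} (X : 'M[R]_n) : set 'M[R]_n :=
  [set U | orthogonal U /\ X = U *m diag_mx (lam X) *m U^T].

Definition mpinv {n : nat} (A : 'M[R]_n) : 'M[R]_n :=
  xget 0 [set B | [/\ A *m B *m A = A, B *m A *m B = B,
                      (A *m B)^T = A *m B & (B *m A)^T = B *m A]].

Definition is_dlam {n : nat} (X H : 'M[R]_n) (d : 'rV[R]_n) : Prop :=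
  forall e : R, 0 < e -> exists2 del : R, 0 < del &
    forall t : R, 0 < t -> t < del ->
      nrm (t^-1 *: (lam (X + t *: H) - lam X) - d) < e.
Definition dlam {n : nat} (X H : 'M[R]_n) : 'rV[R]_n := xget 0 (is_dlam X H).

(* ---------- variational-analysis notions on a subspace E of 'M_(p,q) ---------- *)
Section Var.
Variables (p q : nat) (E : set 'M[R]_(p, q)).
Local Notation M := 'M[R]_(p, q).
Local Open Scope ereal_scope.

Definition liminf_tw (F : R -> M -> \bar R) (w0 : M) : \bar R :=
  ereal_sup [set ereal_inf [set F t w | t in [set t : R | (0 < t)%R /\ (t < d)%R] &
                                        w in [set w | E w /\ (nrm (w - w0) < d)%R]]
            | d in [set d : R | (0 < d)%R]].

Definition dom (f : M -> \bar R) : set M := [set x | E x /\ f x < +oo].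

Definition subdiff (f : M -> \bar R) (x : M) : set M :=
  [set v | E v /\ f x \is a fin_num /\
           forall z, E z -> f x + (inner v (z - x)%R)%:E <= f z].

Definition subderiv (f : M -> \bar R) (x w : M) : \bar R :=
  liminf_tw (fun t w' => (f (x + t *: w')%R - f x) * (t^-1)%:E) w.

Definition crit_cone (f : M -> \bar R) (x v : M) : set M :=
  [set w | E w /\ subderiv f x w = (inner v w)%:E].

(* parabolic difference quotient and parabolic subderivative d^2f(x)(w|z)
   (meaningful when df(x)(w) is finite) *)
Definition parab_quot (f : M -> \bar R) (x w : M) (t : R) (z : M) : \bar R :=
  (f (x + t *: w + (2^-1 * t ^+ 2) *: z)%R - f x - (t * fine (subderiv f x w))%:E)
    * ((2^-1 * t ^+ 2)^-1)%:E.
Definition parab_subderiv (f : M -> \bar R) (x w z : M) : \bar R :=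
  liminf_tw (parab_quot f x w) z.

Definition parab_epi_diff (f : M -> \bar R) (x : M) : Prop :=
  E x /\ f x \is a fin_num /\
  forall w, E w -> subderiv f x w \is a fin_num ->
    (exists2 z, E z & parab_subderiv f x w z < +oo) /\
    forall z, E z -> forall t_ : nat -> R, (forall k, (0 < t_ k)%R) ->
      t_ @ \oo --> (0%R : R) ->
      exists z_ : nat -> M, (forall k, E (z_ k)) /\
        (fun k => nrm (z_ k - z)) @ \oo --> (0%R : R) /\
        (fun k => parab_quot f x w (t_ k) (z_ k)) @ \oo --> parab_subderiv f x w z.

Definition dq2 (f : M -> \bar R) (x v : M) (t : R) (w : M) : \bar R :=
  (f (x + t *: w)%R - f x - (t * inner v w)%:E) * ((2^-1 * t ^+ 2)^-1)%:E.
Definition second_subderiv (f : M -> \bar R) (x v w : M) : \bar R :=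
  liminf_tw (dq2 f x v) w.

Definition parab_regular_for (f : M -> \bar R) (x v : M) : Prop :=
  forall w, E w -> second_subderiv f x v w < +oo ->
    exists t_ : nat -> R, exists w_ : nat -> M,
      [/\ (forall k, (0 < t_ k)%R), t_ @ \oo --> (0%R : R),
          (forall k, E (w_ k)), (fun k => nrm (w_ k - w)) @ \oo --> (0%R : R) &
          (fun k => dq2 f x v (t_ k) (w_ k)) @ \oo --> second_subderiv f x v w] /\
      exists Mb : R, forall k, (nrm (w_ k - w) / t_ k <= Mb)%R.

Definition parab_regular (f : M -> \bar R) (x : M) : Prop :=
  forall v, subdiff f x v -> parab_regular_for f x v.

Definition never_minfty (f : M -> \bar R) : Prop := forall x, E x -> f x != -oo.

Definition loc_lipschitz_rel_dom (f : M -> \bar R) : Prop :=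
  forall a, dom f a -> exists l : R, exists2 del : R, (0 < del)%R &
    forall b c, dom f b -> dom f c -> (nrm (b - a) < del)%R -> (nrm (c - a) < del)%R ->
      (`|fine (f b) - fine (f c)| <= l * nrm (b - c))%R.

Definition lsc (f : M -> \bar R) : Prop :=
  forall x, E x -> forall r : R, r%:E < f x -> exists2 del : R, (0 < del)%R &
    forall y, E y -> (nrm (y - x) < del)%R -> r%:E < f y.

Definition convex_fun (f : M -> \bar R) : Prop :=
  forall a b, E a -> E b -> forall t : R, (0 <= t)%R -> (t <= 1)%R ->
    f (t *: a + (1 - t) *: b)%R <= t%:E * f a + (1 - t)%R%:E * f b.

End Var.
(* 2nd-order "curvature" term:
   sum_{m=1}^r < Lambda(Y)_{a_m a_m}, U_{a_m}^T H (mu_m I - X)^+ H U_{a_m} >,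
   mu_1..mu_r the distinct eigenvalues of X, a_m = {i | lambda_i(X) = mu_m};
   the trace inner product of the alpha_m x alpha_m blocks is written out entrywise. *)
Definition curv_term {n : nat} (X Y U H : 'M[R]_n) : R :=
  \sum_(mu <- undup [seq lam X ord0 i | i <- enum 'I_n])
    \sum_(i : 'I_n | lam X ord0 i == mu) \sum_(j : 'I_n | lam X ord0 j == mu)
      diag_mx (lam Y) i j * (U^T *m H *m mpinv (mu%:M - X) *m H *m U) i j.

End Defs.

(* Main.v *)
(* By Fan's inequality <lam Y, lam A> is the maximum of <V Y V^T, A> over
   orthogonal V, so second-order lower estimates follow by testing one
   well-chosen rotation, and upper ones by exhibiting curves along which they are
   exact. In coordinates where X = Diag(x) and Y = Diag(y), that rotation is the
   Cayley transform C of t A, with A_ij = H_ij / (x_j - x_i) between different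
   eigenvalue blocks and 0 inside them.

   (a) Lower bound: with h_t = (lam(X + t H') - x) / t, which tends to lam'(X; H),
   the second-order quotient of g at H' equals that of theta at h_t plus a term
   which Fan's inequality for C bounds below by the curvature term. Upper bound:
   for critical H, equality in Fan's inequality gives an orthogonal P commuting
   with X and Y that diagonalizes the blocks of H; if t_k, w_k realize parabolic
   regularity of theta, then C P Diag(x + t_k w_k) (C P)^T is X + t_k H_k with
   |H_k - H| = O(t_k), and g takes there exactly the value theta(x + t_k w_k).

   (b) Averaging over sign flips gives theta(diag Z) <= g(Z). So for a subgradient
   v of theta at x, Diag(v) is a subgradient of g at Diag(x), the second
   subderivatives agree on diagonal directions, and the diagonals of the H_k
   realizing the regularity of g realize that of theta.

   The spectral facts (diagonalization, Fan's inequality and its equality case,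
   simultaneous diagonalization of X and Y) all come from maximizing a linear
   function over a compact group of orthogonal matrices. *)
Require Import Defs.
From HB Require Import structures.
From mathcomp Require Import all_boot all_order all_algebra.
From mathcomp Require Import all_classical all_reals.
From mathcomp Require Import ereal topology normedtype sequences derive.
From mathcomp Require Import perm.
From mathcomp Require Import ring lra.
(* [Defs] again, because [all_algebra] shadows [orthogonal]. *)
Import Defs numFieldNormedType.Exports.
Import Order.TTheory GRing.Theory Num.Theory.
Local Open Scope classical_set_scope.
Local Open Scope ring_scope.

Set Implicit Arguments. Unset Strict Implicit. Unset Printing Implicit Defensive.

Ltac mxabel :=
  repeat match goal with |- context [?A *m ?B] =>
    let P := fresh in set P := (A *m B); clearbody P end;
  apply/matrixP=> ? ?; rewrite !mxE; first [ring | field].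

(** * Frobenius inner product *)

Section Frobenius.
Variable R : realType.
Implicit Types p q n : nat.

Lemma innerE p q (A B : 'M[R]_(p, q)) : inner A B = \sum_i \sum_j A i j * B i j.
Proof.
rewrite /inner /mxtrace exchange_big; apply: eq_bigr => j _.
by rewrite mxE; apply: eq_bigr => i _; rewrite !mxE.
Qed.

Lemma innerC p q (A B : 'M[R]_(p, q)) : inner A B = inner B A.
Proof. by rewrite /inner -mxtrace_tr trmx_mul trmxK. Qed.

Lemma innerDr p q (A B C : 'M[R]_(p, q)) : inner A (B + C) = inner A B + inner A C.
Proof. by rewrite /inner mulmxDr mxtraceD. Qed.

Lemma innerZr p q a (A B : 'M[R]_(p, q)) : inner A (a *: B) = a * inner A B.
Proof. by rewrite /inner -scalemxAr mxtraceZ. Qed.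

Lemma innerNr p q (A B : 'M[R]_(p, q)) : inner A (- B) = - inner A B.
Proof. by rewrite -scaleN1r innerZr mulN1r. Qed.

Lemma innerBr p q (A B C : 'M[R]_(p, q)) : inner A (B - C) = inner A B - inner A C.
Proof. by rewrite innerDr innerNr. Qed.

Lemma innerDl p q (A B C : 'M[R]_(p, q)) : inner (A + B) C = inner A C + inner B C.
Proof. by rewrite !(innerC _ C) innerDr. Qed.

Lemma innerZl p q a (A B : 'M[R]_(p, q)) : inner (a *: A) B = a * inner A B.
Proof. by rewrite !(innerC _ B) innerZr. Qed.

Lemma innerNl p q (A B : 'M[R]_(p, q)) : inner (- A) B = - inner A B.
Proof. by rewrite !(innerC _ B) innerNr. Qed.

Lemma innerBl p q (A B C : 'M[R]_(p, q)) : inner (A - B) C = inner A C - inner B C.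
Proof. by rewrite innerDl innerNl. Qed.

Lemma inner0r p q (A : 'M[R]_(p, q)) : inner A 0 = 0.
Proof. by rewrite /inner mulmx0 mxtrace0. Qed.

Lemma inner0l p q (A : 'M[R]_(p, q)) : inner 0 A = 0.
Proof. by rewrite innerC inner0r. Qed.

Lemma inner_tr p q (A B : 'M[R]_(p, q)) : inner A^T B^T = inner A B.
Proof. by rewrite innerC /inner trmxK mxtrace_mulC. Qed.

Lemma inner_ge0 p q (A : 'M[R]_(p, q)) : 0 <= inner A A.
Proof.
by rewrite innerE; do 2![apply: sumr_ge0 => ? _]; rewrite -expr2 sqr_ge0.
Qed.

Lemma inner_eq0 p q (A : 'M[R]_(p, q)) : inner A A = 0 -> A = 0.
Proof.
rewrite innerE => /eqP; rewrite psumr_eq0 => [|i _]; last first.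
  by apply: sumr_ge0 => ? _; rewrite -expr2 sqr_ge0.
move=> /allP A0; apply/matrixP=> i j; have := A0 i (mem_index_enum i).
rewrite /= psumr_eq0 => [|k _]; last by rewrite -expr2 sqr_ge0.
move=> /allP/(_ j (mem_index_enum j)) /=.
by rewrite -expr2 sqrf_eq0 mxE => /eqP.
Qed.

Lemma nrm_ge0 p q (A : 'M[R]_(p, q)) : 0 <= nrm A.
Proof. exact: sqrtr_ge0. Qed.

Lemma nrm_sqr p q (A : 'M[R]_(p, q)) : nrm A ^+ 2 = inner A A.
Proof. by rewrite sqr_sqrtr ?inner_ge0. Qed.

Lemma nrm0 p q : nrm (0 : 'M[R]_(p, q)) = 0.
Proof. by rewrite /nrm inner0r sqrtr0. Qed.

Lemma nrm0_eq0 p q (A : 'M[R]_(p, q)) : nrm A = 0 -> A = 0.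
Proof. by move=> A0; apply: inner_eq0; rewrite -nrm_sqr A0 expr0n. Qed.

Lemma nrmZ p q a (A : 'M[R]_(p, q)) : nrm (a *: A) = `|a| * nrm A.
Proof.
by rewrite /nrm innerZl innerZr mulrA -expr2 sqrtrM ?sqr_ge0// sqrtr_sqr.
Qed.

Lemma nrmN p q (A : 'M[R]_(p, q)) : nrm (- A) = nrm A.
Proof. by rewrite -scaleN1r nrmZ normrN1 mul1r. Qed.

Lemma nrm_tr p q (A : 'M[R]_(p, q)) : nrm A^T = nrm A.
Proof. by rewrite /nrm inner_tr. Qed.

Lemma inner_sqr_le p q (A B : 'M[R]_(p, q)) :
  inner A B ^+ 2 <= inner A A * inner B B.
Proof.
have [B0|B_neq0] := eqVneq (inner B B) 0.
  by rewrite (inner_eq0 B0) !inner0r mulr0 expr0n.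
have B_gt0 : 0 < inner B B by rewrite lt_neqAle eq_sym B_neq0 inner_ge0.
(* Cauchy-Schwarz from the squared component of [A] orthogonal to [B], scaled by [inner B B] to
   avoid a division. *)
have := inner_ge0 (inner B B *: A - inner A B *: B).
rewrite !(innerBl, innerBr, innerZl, innerZr) (innerC B A).
rewrite (_ : _ - _ = inner B B * (inner A A * inner B B - inner A B ^+ 2)).
  by rewrite pmulr_rge0// subr_ge0.
ring.
Qed.

Lemma norm_inner_le p q (A B : 'M[R]_(p, q)) : `|inner A B| <= nrm A * nrm B.
Proof.
rewrite -(@ler_pXn2r _ 2) ?nnegrE ?mulr_ge0 ?nrm_ge0//.
by rewrite exprMn !nrm_sqr real_normK ?num_real// inner_sqr_le.
Qed.

Lemma inner_le p q (A B : 'M[R]_(p, q)) : inner A B <= nrm A * nrm B.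
Proof. exact: le_trans (ler_norm _) (norm_inner_le A B). Qed.

Lemma nrmD p q (A B : 'M[R]_(p, q)) : nrm (A + B) <= nrm A + nrm B.
Proof.
rewrite -(@ler_pXn2r _ 2) ?nnegrE ?addr_ge0 ?nrm_ge0//.
rewrite sqrrD !nrm_sqr !(innerDl, innerDr) (innerC B A).
have := inner_le A B; lra.
Qed.

Lemma nrmB p q (A B : 'M[R]_(p, q)) : nrm (A - B) <= nrm A + nrm B.
Proof. by rewrite -(nrmN B) nrmD. Qed.

Lemma nrm_distC p q (A B : 'M[R]_(p, q)) : nrm (A - B) = nrm (B - A).
Proof. by rewrite -nrmN opprB. Qed.

Lemma nrm_triangle p q (C A B : 'M[R]_(p, q)) :
  nrm (A - B) <= nrm (A - C) + nrm (C - B).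
Proof. by rewrite (_ : A - B = (A - C) + (C - B)) ?nrmD// addrA subrK. Qed.

Lemma nrmM p q n (A : 'M[R]_(p, q)) (B : 'M[R]_(q, n)) :
  nrm (A *m B) <= nrm A * nrm B.
Proof.
rewrite -(@ler_pXn2r _ 2) ?nnegrE ?mulr_ge0 ?nrm_ge0//.
rewrite exprMn !nrm_sqr -(inner_tr B) !innerE mulr_suml.
apply: ler_sum => i _; rewrite mulr_sumr; apply: ler_sum => j _.
have := inner_sqr_le (row i A) (col j B)^T.
rewrite (_ : inner _ _ = (A *m B) i j) ?expr2; last first.
  by rewrite innerE big_ord1 mxE; apply: eq_bigr => k _; rewrite !mxE.
move=> /le_trans; apply; rewrite !innerE !big_ord1.
under eq_bigr do rewrite !mxE.
under [X in _ * X <= _]eq_bigr do rewrite !mxE.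
by under [X in _ <= _ * X]eq_bigr do rewrite !mxE.
Qed.

Lemma inner_diag n (x : 'rV[R]_n) (A : 'M[R]_n) :
  inner (diag_mx x) A = inner x (\row_i A i i).
Proof.
rewrite !innerE big_ord1; apply: eq_bigr => i _.
rewrite (bigD1 i)//= big1 ?addr0 => [|j ji]; first by rewrite !mxE eqxx.
by rewrite mxE eq_sym (negPf ji) mul0r.
Qed.

Lemma inner_diag_diag n (x y : 'rV[R]_n) :
  inner (diag_mx x) (diag_mx y) = inner x y.
Proof.
rewrite inner_diag; congr inner; apply/rowP=> i.
by rewrite !mxE eqxx.
Qed.

Lemma nrm_diag n (x : 'rV[R]_n) : nrm (diag_mx x) = nrm x.
Proof. by rewrite /nrm inner_diag_diag. Qed.

Lemma diag_mxB n (x y : 'rV[R]_n) : diag_mx (x - y) = diag_mx x - diag_mx y.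
Proof. exact: raddfB. Qed.

Lemma diag_mxD n (x y : 'rV[R]_n) : diag_mx (x + y) = diag_mx x + diag_mx y.
Proof. exact: raddfD. Qed.

Lemma diag_mxZ n a (x : 'rV[R]_n) : diag_mx (a *: x) = a *: diag_mx x.
Proof. exact: linearZ. Qed.

End Frobenius.

(** * Orthogonal conjugation, commutators and the Cayley transform *)

Section Orthogonal.
Variable (R : realType) (n : nat).
Implicit Types A B C D U V M : 'M[R]_n.

Lemma orthogonalP U : orthogonal U <-> U *m U^T = 1%:M.
Proof. by split=> /mulmx1C. Qed.

Lemma orthogonal_tr U : orthogonal U -> orthogonal U^T.
Proof. by move=> /orthogonalP UU; rewrite /orthogonal trmxK. Qed.

Lemma orthogonal1 : orthogonal (1%:M : 'M[R]_n).
Proof. by rewrite /orthogonal trmx1 mulmx1. Qed.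

Lemma orthogonalM U V : orthogonal U -> orthogonal V -> orthogonal (U *m V).
Proof.
by move=> UU VV; rewrite /orthogonal trmx_mul mulmxA -(mulmxA V^T) UU mulmx1.
Qed.

Lemma conj_orthK U A : orthogonal U -> U *m (U^T *m A *m U) *m U^T = A.
Proof.
move=> /orthogonalP UU.
by rewrite !mulmxA UU mul1mx -mulmxA UU mulmx1.
Qed.

Lemma conj_orthVK U A : orthogonal U -> U^T *m (U *m A *m U^T) *m U = A.
Proof. by move=> /orthogonal_tr/(conj_orthK A); rewrite trmxK. Qed.

Lemma inner_orth U A B :
  orthogonal U -> inner (U *m A *m U^T) (U *m B *m U^T) = inner A B.
Proof.
move=> UU; rewrite /inner !trmx_mul trmxK !mulmxA -(mulmxA _ U^T U) UU mulmx1.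
by rewrite mxtrace_mulC !mulmxA UU mul1mx.
Qed.

Lemma inner_conjr U A B : inner A (U *m B *m U^T) = inner (U^T *m A *m U) B.
Proof.
by rewrite /inner !trmx_mul trmxK -!mulmxA [RHS]mxtrace_mulC -!mulmxA.
Qed.

Lemma nrm_orth U A : orthogonal U -> nrm (U *m A *m U^T) = nrm A.
Proof. by move=> UU; rewrite /nrm inner_orth. Qed.

Lemma nrm_orthogonal U : orthogonal U -> nrm U = nrm (1%:M : 'M[R]_n).
Proof. by move=> UU; rewrite /nrm /inner UU trmx1 mulmx1. Qed.

Lemma symm_conj U A : symm A -> symm (U *m A *m U^T).
Proof. by rewrite /symm /= => AT; rewrite !trmx_mul trmxK AT mulmxA. Qed.

Lemma symm_diag (x : 'rV[R]_n) : symm (diag_mx x).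
Proof. by rewrite /symm /= tr_diag_mx. Qed.

Lemma symmD A B : symm A -> symm B -> symm (A + B).
Proof. by rewrite /symm /= => AT BT; rewrite linearD /= AT BT. Qed.

Lemma symmZ a A : symm A -> symm (a *: A).
Proof. by rewrite /symm /= => AT; rewrite linearZ /= AT. Qed.

Lemma symmB A B : symm A -> symm B -> symm (A - B).
Proof. by rewrite /symm /= => AT BT; rewrite linearB /= AT BT. Qed.

(* Locked so that linearity lemmas do not see through the difference. *)
Definition lie A M : 'M[R]_n := locked (A *m M - M *m A).

Lemma lieE A M : lie A M = A *m M - M *m A.
Proof. by rewrite /lie -lock. Qed.

Lemma lieB A M1 M2 : lie A (M1 - M2) = lie A M1 - lie A M2.
Proof. by rewrite !lieE !(mulmxBr, mulmxBl); mxabel. Qed.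

Lemma lieN A M : lie (- A) M = - lie A M.
Proof. by rewrite !lieE mulNmx mulmxN opprK opprB addrC. Qed.

Lemma lieNr A M : lie A (- M) = - lie A M.
Proof. by rewrite !lieE mulNmx mulmxN opprK opprB addrC. Qed.

(** Cyclicity of the trace. The pairing thus vanishes when [Y] and [M] commute, and the choice
    [A = lie Y M] turns it into a square. *)
Lemma inner_lie A Y M : A^T = - A -> symm Y ->
  inner Y (lie A M) = inner A (lie Y M).
Proof.
rewrite /symm /= => AT YT; rewrite /inner !lieE AT YT !(mulNmx, mulmxBr) !mulmxA.
have trN (Z : 'M[R]_n) : \tr (- Z) = - \tr Z.
  by rewrite -scaleN1r mxtraceZ mulN1r.
rewrite trN !mxtraceD !trN (mxtrace_mulC (Y *m M)) mulmxA.
by rewrite (_ : \tr (A *m M *m Y) = \tr (Y *m A *m M)) ?opprB// mxtrace_mulC mulmxA.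
Qed.

(* The Cayley transform of a skew-symmetric [t *: A]. The fixed-point form of
   the second conjunct yields the Taylor expansion of [C] at [t = 0] by
   bootstrapping, without estimating any inverse. *)
Lemma cayley A (t : R) : A^T = - A ->
  exists C, [/\ orthogonal C, C - 1%:M = (t / 2) *: (A *m (C + 1%:M)) &
     forall D, A *m D = D *m A -> C *m D = D *m C].
Proof.
move=> AT; set M := 1%:M - (t / 2) *: A; set N := 1%:M + (t / 2) *: A.
have Munit : M \in unitmx.
  rewrite -row_free_unit; apply/row_freeP.
  (* If [u *m M = 0] then [u] is [t / 2] times [u *m A], which is orthogonal to [u] by skewness; so
     [u = 0]. *)
  have /eqP kerM0 : kermx M == 0.
    apply/eqP/row_matrixP => i; rewrite row0.
    set u := row i (kermx M); have : u *m M = 0 by rewrite -row_mul mulmx_ker row0.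
    rewrite mulmxBr mulmx1 -scalemxAr => /eqP; rewrite subr_eq0 => /eqP uE.
    apply: inner_eq0; rewrite {2}uE innerZr /inner.
    have : \tr (u^T *m (u *m A)) = - \tr (u^T *m (u *m A)).
      rewrite -[LHS]mxtrace_tr !trmx_mul trmxK AT mulNmx mulNmx linearN /=.
      by rewrite -mulmxA mxtrace_mulC mulmxA.
    by move=> trE; rewrite (_ : \tr _ = 0) ?mulr0//; lra.
  by exists (invmx M); rewrite mulmxV// -row_free_unit -kermx_eq0 kerM0.
have MN : M^T = N by rewrite /M linearB /= linearZ /= AT trmx1 scalerN opprK.
have NM : N^T = M by rewrite -MN trmxK.
have MNC : M *m N = N *m M.
  rewrite mulmxBl mul1mx mulmxDl mul1mx mulmxBr mulmxDr !mulmx1.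
  by rewrite opprD addrA addrK addrA subrK.
exists (N *m invmx M); split.
- rewrite /orthogonal trmx_mul trmx_inv NM MN -mulmxA (mulmxA M) MNC -(mulmxA N).
  by rewrite mulmxV// mulmx1 mulVmx// -MN unitmx_tr.
- rewrite -(mulmxV Munit) -mulmxBl -mulmxDl mulmxA scalemxAl; congr (_ *m _).
  rewrite /N /M !mulmxDr !mulmxN !mulmx1.
  by rewrite opprD opprK addrACA subrr add0r addrACA subrr addr0 scalerDr.
- move=> D AD.
  have MD : M *m D = D *m M.
    by rewrite /M mulmxBl mulmxBr mul1mx mulmx1 -scalemxAl -scalemxAr AD.
  have ND : N *m D = D *m N.
    by rewrite /N mulmxDl mulmxDr mul1mx mulmx1 -scalemxAl -scalemxAr AD.
  rewrite -mulmxA (_ : invmx M *m D = D *m invmx M) ?mulmxA ?ND//.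
  by rewrite -[LHS](mulmxK Munit) -!(mulmxA _ D) -MD mulKmx.
Qed.

End Orthogonal.

(** * Rotations and maximization over orthogonal matrices *)

Section Expansion.
Variable (R : realType) (n : nat).
Implicit Types A B C D U V M : 'M[R]_n.

(** One [K] serves all [t > 0], since every orthogonal matrix has the norm of the identity; it is
    the sum of the constants of the three remainder bounds. *)
Lemma conj_expand A : A^T = - A -> exists2 K : R, 0 <= K & forall t, 0 < t ->
  exists C, [/\ orthogonal C, forall D, A *m D = D *m A -> C *m D = D *m C &
    forall M, [/\ nrm (C *m M *m C^T - M) <= K * t * nrm M,
      nrm (C *m M *m C^T - M - t *: lie A M) <= K * t ^+ 2 * nrm M &
      nrm (C *m M *m C^T - M - t *: lie A M - (t ^+ 2 / 2) *: lie A (lie A M))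
        <= K * t ^+ 3 * nrm M]].
Proof.
move=> AT; pose a := nrm A; pose s := nrm (1%:M : 'M[R]_n).
have a0 : 0 <= a by exact: nrm_ge0.
have s0 : 0 <= s by exact: nrm_ge0.
exists (a * s * (s + 1) + (2 * a ^+ 2 * s + a ^+ 2 * s ^+ 2)
  + (2 * a ^+ 3 * s + (a ^+ 3 * s ^+ 2 + a ^+ 3 * s))).
  by rewrite !addr_ge0 ?mulr_ge0 ?exprn_ge0 ?addr_ge0.
move=> t t0; have [C [CO CE CC]] := cayley t AT.
exists C; split=> // M.
have t20 : 0 <= t / 2 by lra.
have Cs : nrm C = s by rewrite nrm_orthogonal.
(* Taylor remainders of [C]: reinserting the fixed-point equation gives [e1 = t *: A + e2] and
   [e2 = (t ^+ 2 / 2) *: (A *m A) + e3], each gaining one power of [t]. *)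
pose e1 := C - 1%:M; pose e2 := (t / 2) *: (A *m e1); pose e3 := (t / 2) *: (A *m e2).
have e12 : e1 = t *: A + e2.
  rewrite /e2 {1}/e1 CE (_ : C + 1%:M = e1 + 1%:M + 1%:M) ?subrK//.
  rewrite !mulmxDr !mulmx1 !scalerDr -[RHS]addrC -addrA; congr (_ + _).
  by rewrite mulmxN mulmx1 scalerN -scaleNr -scalerDl; congr (_ *: _); lra.
have e23 : e2 = (t ^+ 2 / 2) *: (A *m A) + e3.
  rewrite /e3 {1}/e2 e12 mulmxDr -scalemxAr scalerDr scalerA; congr (_ *: _ + _).
  by rewrite expr2; lra.
have ne1 : nrm e1 <= t * a * s.
  rewrite /e1 CE nrmZ ger0_norm//.
  have : nrm (A *m (C + 1%:M)) <= a * (s + s).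
    by apply: le_trans (nrmM _ _) _; rewrite ler_wpM2l// (le_trans (nrmD _ _))// Cs.
  by move=> /(ler_wpM2l t20) /le_trans; apply; lra.
have ne2 : nrm e2 <= t ^+ 2 * a ^+ 2 * s.
  rewrite /e2 nrmZ ger0_norm//.
  have : nrm (A *m e1) <= a * (t * a * s).
    by apply: le_trans (nrmM _ _) _; rewrite ler_wpM2l.
  move=> /(ler_wpM2l t20) /le_trans; apply.
  have : 0 <= t ^+ 2 * a ^+ 2 * s by rewrite !mulr_ge0 ?exprn_ge0// ltW.
  by rewrite !expr2; lra.
have ne3 : nrm e3 <= t ^+ 3 * a ^+ 3 * s.
  rewrite /e3 nrmZ ger0_norm//.
  have : nrm (A *m e2) <= a * (t ^+ 2 * a ^+ 2 * s).
    by apply: le_trans (nrmM _ _) _; rewrite ler_wpM2l.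
  move=> /(ler_wpM2l t20) /le_trans; apply.
  have : 0 <= t ^+ 3 * a ^+ 3 * s by rewrite !mulr_ge0 ?exprn_ge0// ltW.
  by rewrite !exprS !expr0; lra.
have CE1 : C = 1%:M + e1 by rewrite /e1 addrCA subrr addr0.
have bound2 (X Y : 'M[R]_n) x y : nrm X <= x -> nrm Y <= y ->
    nrm (X *m M *m Y^T) <= x * y * nrm M.
  move=> Xx Yy; apply: le_trans (nrmM _ _) _; rewrite nrm_tr mulrAC.
  have Y0 := nrm_ge0 Y.
  apply: ler_pM; rewrite ?nrm_ge0//; apply: le_trans (nrmM _ _) _.
  by rewrite ler_wpM2r ?nrm_ge0.
have boundl (X : 'M[R]_n) x : nrm X <= x -> nrm (X *m M) <= x * nrm M.
  by move=> Xx; apply: le_trans (nrmM _ _) _; rewrite ler_wpM2r ?nrm_ge0.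
have boundr (X : 'M[R]_n) x : nrm X <= x -> nrm (M *m X^T) <= x * nrm M.
  move=> Xx; apply: le_trans (nrmM _ _) _.
  by rewrite mulrC nrm_tr ler_wpM2r ?nrm_ge0.
have M0 := nrm_ge0 M; have tge0 := ltW t0.
have e1T : e1^T = - (t *: A) + e2^T by rewrite e12 linearD /= linearZ /= AT scalerN.
have e2T : e2^T = (t ^+ 2 / 2) *: (A *m A) + e3^T.
  by rewrite e23 linearD /= linearZ /= trmx_mul AT mulNmx mulmxN opprK.
have E0 : C *m M *m C^T = M + e1 *m M + (M *m e1^T + e1 *m M *m e1^T).
  by rewrite CE1 linearD /= trmx1 mulmxDl mul1mx mulmxDr mulmx1 mulmxDl.
have E1 : e1 *m M = t *: (A *m M) + e2 *m M by rewrite e12 mulmxDl -scalemxAl.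
have E2 : M *m e1^T = - (t *: (M *m A)) + M *m e2^T.
  by rewrite e1T mulmxDr mulmxN -scalemxAr.
have E3 : e1 *m M *m e1^T = - (t ^+ 2 *: (A *m M *m A)) + (t *: A) *m M *m e2^T
    + e2 *m M *m e1^T.
  rewrite {1}e12 mulmxDl mulmxDl {1}e1T mulmxDr; congr (_ + _ + _).
  by rewrite mulmxN -!scalemxAl -scalemxAr scalerA.
have E4 : e2 *m M = (t ^+ 2 / 2) *: (A *m A *m M) + e3 *m M.
  by rewrite e23 mulmxDl -scalemxAl.
have E5 : M *m e2^T = (t ^+ 2 / 2) *: (M *m A *m A) + M *m e3^T.
  by rewrite e2T mulmxDr -scalemxAr mulmxA.
clearbody e1 e2 e3.
split.
- rewrite (_ : _ - M = e1 *m M *m C^T + M *m e1^T); last first.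
    rewrite E0 (_ : C^T = 1%:M + e1^T); last by rewrite CE1 linearD /= trmx1.
    by rewrite mulmxDr mulmx1; mxabel.
  apply: le_trans (nrmD _ _) _.
  apply: le_trans (lerD (bound2 _ _ _ _ ne1 (lexx _)) (boundr _ _ ne1)) _.
  rewrite Cs -mulrDl ler_wpM2r//.
  rewrite (_ : _ + _ = t * (a * s * (s + 1))); last ring.
  by rewrite mulrC ler_wpM2r// -addrA lerDl !addr_ge0 ?mulr_ge0 ?exprn_ge0.
- rewrite E0 {1}E1 E2 !lieE (_ : _ - _ = e2 *m M + M *m e2^T + e1 *m M *m e1^T).
    apply: le_trans (nrmD _ _) _; apply: le_trans (lerD (nrmD _ _) (bound2 _ _ _ _ ne1 ne1)) _.
    apply: le_trans (lerD (lerD (boundl _ _ ne2) (boundr _ _ ne2)) (lexx _)) _.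
    rewrite [leLHS](_ : _ = (2 * a ^+ 2 * s + a ^+ 2 * s ^+ 2) * t ^+ 2 * nrm M); last ring.
    rewrite ler_wpM2r// ler_wpM2r ?exprn_ge0//.
    by rewrite addrAC lerDr !addr_ge0 ?mulr_ge0 ?exprn_ge0 ?addr_ge0.
  by mxabel.
- rewrite E0 {1}E1 E2 E3 {1}E4 E5 !lieE.
  rewrite (_ : _ - _ = e3 *m M + M *m e3^T + (e2 *m M *m e1^T + (t *: A) *m M *m e2^T)).
    have ntA : nrm (t *: A) <= t * a by rewrite nrmZ ger0_norm.
    apply: le_trans (nrmD _ _) _; apply: le_trans (lerD (nrmD _ _) (nrmD _ _)) _.
    apply: le_trans (lerD (lerD (boundl _ _ ne3) (boundr _ _ ne3))
      (lerD (bound2 _ _ _ _ ne2 ne1) (bound2 _ _ _ _ ntA ne2))) _.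
    rewrite [leLHS](_ : _ = (2 * a ^+ 3 * s + (a ^+ 3 * s ^+ 2 + a ^+ 3 * s)) * t ^+ 3 * nrm M);
      last ring.
    rewrite ler_wpM2r// ler_wpM2r ?exprn_ge0//.
    by rewrite lerDr !addr_ge0 ?mulr_ge0 ?exprn_ge0 ?addr_ge0.
  rewrite -!scalemxAl !(mulmxBr, mulmxBl) !mulmxA.
  by mxabel.
Qed.

(** All orthogonal matrices when [Z] is empty; those preserving the blocks of equal entries of [x]
    when [Z] is the single matrix [diag_mx x]. *)
Definition orthC (Z : set 'M[R]_n) : set 'M[R]_n :=
  [set P | orthogonal P /\ forall D, Z D -> P *m D = D *m P].

Lemma orthC1 Z : orthC Z 1%:M.
Proof. by split=> [|D _]; [exact: orthogonal1|rewrite mul1mx mulmx1]. Qed.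

Lemma orthCM Z P Q : orthC Z P -> orthC Z Q -> orthC Z (P *m Q).
Proof.
move=> [PO PC] [QO QC]; split=> [|D ZD]; first exact: orthogonalM.
by rewrite -mulmxA QC// mulmxA PC// mulmxA.
Qed.

Lemma comm_tr P D : orthogonal P -> P *m D = D *m P -> P^T *m D = D *m P^T.
Proof.
move=> PO PD; have := PO; rewrite orthogonalP => PO'.
by rewrite -[D in LHS]mulmx1 -PO' !mulmxA -(mulmxA P^T D) -PD mulmxA PO mul1mx.
Qed.

Lemma orthC_tr Z P : orthC Z P -> orthC Z P^T.
Proof.
move=> [PO PC]; split=> [|D ZD]; first exact: orthogonal_tr.
by apply: comm_tr => //; exact: PC.
Qed.

Lemma continuous_sum (T : topologicalType) (I : Type) (r : seq I) (F : I -> T -> R) :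
  (forall i, continuous (F i)) -> continuous (fun v => \sum_(i <- r) F i v).
Proof.
move=> cF; elim: r => [|i r IH] v.
  by rewrite (_ : (fun _ => _) = cst 0); [exact: cvg_cst|apply/funext => u; rewrite big_nil].
rewrite (_ : (fun _ => _) = F i \+ (fun v => \sum_(j <- r) F j v)).
  by apply: cvgD; [exact: cF|exact: IH].
by apply/funext => u; rewrite big_cons.
Qed.

Lemma continuous_subr (T : topologicalType) (f g : T -> R) :
  continuous f -> continuous g -> continuous (fun v => f v - g v).
Proof. by move=> cf cg v; exact: cvgB (cf v) (cg v). Qed.

Lemma continuous_vec_mx i j : continuous (fun v : 'rV[R]_(n * n) => (vec_mx v : 'M[R]_n) i j).
Proof.
rewrite (_ : (fun _ => _) = (fun v : 'rV_(n * n) => v ord0 (mxvec_index i j))).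
  exact: coord_continuous.
by apply/funext => v; rewrite mxE.
Qed.

(** Compactness: the group is cut out by polynomial equations and has bounded entries. Matrices are
    flattened to row vectors in order to apply Heine-Borel. *)
Lemma orth_max Z Y B : exists2 P, orthC Z P & forall Q, orthC Z Q ->
  inner Y (Q *m B *m Q^T) <= inner Y (P *m B *m P^T).
Proof.
pose K := [set v : 'rV[R]_(n * n) | orthC Z (vec_mx v)].
pose f (v : 'rV[R]_(n * n)) := inner Y (vec_mx v *m B *m (vec_mx v)^T).
have K0 : K !=set0 by exists (mxvec 1%:M); rewrite /K /= mxvecK; exact: orthC1.
have c0 (c : R) : closed [set c].
  by rewrite (_ : [set c] = [set x : R | x = c])//; exact: closed_eq.
have cK : compact K.
  apply: bounded_closed_compact.
    exists 1; split=> // x x1 v [/= vO _].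
    apply: le_trans (ltW x1).
    rewrite [leLHS]/Num.Def.normr/= mx_normrE; apply: bigmax_le => //= -[i k] _ /=.
    rewrite -[v]vec_mxK ord1.
    case/mxvec_indexP: k => k l; rewrite mxvecE.
    (* A column of an orthogonal matrix has unit length, which bounds its entries by one. *)
    have /matrixP/(_ l l) := vO; rewrite !mxE eqxx mulr1n => E.
    rewrite -(@ler_pXn2r _ 2) ?nnegrE// expr1n real_normK ?num_real//.
    rewrite -E (bigD1 k)//= !mxE -expr2 lerDl sumr_ge0// => m _.
    by rewrite !mxE -expr2 sqr_ge0.
  rewrite (_ : K = (\bigcap_(ij in [set: 'I_n * 'I_n])
      ((fun v : 'rV[R]_(n * n) => \sum_k (vec_mx v : 'M[R]_n) k ij.1 * (vec_mx v : 'M[R]_n) k ij.2)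
         @^-1` [set (ij.1 == ij.2)%:R])) `&`
    (\bigcap_(D in Z) \bigcap_(ij in [set: 'I_n * 'I_n])
      ((fun v : 'rV[R]_(n * n) => \sum_k ((vec_mx v : 'M[R]_n) ij.1 k * D k ij.2
         - D ij.1 k * (vec_mx v : 'M[R]_n) k ij.2)) @^-1` [set 0]))).
    apply: closedI.
      apply: closed_bigI => -[i j] _ /=; apply: preimage_closed => // v _.
      apply: continuous_sum => k u.
      by apply: continuousM; exact: continuous_vec_mx.
    apply: closed_bigI => D _; apply: closed_bigI => -[i j] _ /=.
    apply: preimage_closed => // v _.
    apply: continuous_sum => k u.
    apply: (@continuous_subr _ (fun w : 'rV[R]_(n * n) => (vec_mx w : 'M[R]_n) i k * D k j)
      (fun w => D i k * (vec_mx w : 'M[R]_n) k j)) => w.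
      by apply: continuousM; [exact: continuous_vec_mx|exact: cst_continuous].
    by apply: continuousM; [exact: cst_continuous|exact: continuous_vec_mx].
  apply/seteqP; split=> [v [vO vC]|v [vO vC]].
    split=> [[i j] _|D ZD [i j] _] /=.
      have /matrixP/(_ i j) := vO; rewrite !mxE => <-.
      by apply: eq_bigr => k _; rewrite !mxE.
    apply/eqP; rewrite sumrB subr_eq0.
    by have /matrixP/(_ i j) := vC _ ZD; rewrite !mxE => ->.
  split=> [|D ZD]; apply/matrixP => i j; rewrite !mxE.
    by have /= <- := vO (i, j) I; apply: eq_bigr => k _; rewrite !mxE.
  apply/eqP; rewrite -subr_eq0.
  by have /= := vC D ZD (i, j) I => /eqP; rewrite sumrB.
have cf : continuous f.
  rewrite (_ : f = fun v => \sum_i \sum_j Y i j * (\sum_k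
     (\sum_l (vec_mx v : 'M[R]_n) i l * B l k) * (vec_mx v : 'M[R]_n) j k)).
    apply: continuous_sum => i; apply: continuous_sum => j u.
    apply: continuousM; first exact: cst_continuous.
    apply: continuous_sum => k w; apply: continuousM; last exact: continuous_vec_mx.
    apply: continuous_sum => l z; apply: continuousM; last exact: cst_continuous.
    exact: continuous_vec_mx.
  apply/funext => v; rewrite /f innerE; apply: eq_bigr => i _; apply: eq_bigr => j _.
  by rewrite mxE; congr (_ * _); apply: eq_bigr => k _; rewrite !mxE.
have [v] := compact_EVT_max K0 cK (continuous_subspaceT cf).
rewrite inE => Kv vmax; exists (vec_mx v) => // Q QO.
have := vmax (mxvec Q); rewrite inE /f mxvecK; apply.
by rewrite /K /= mxvecK.
Qed.

End Expansion.

(** * Spectra and Fan's inequality *)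

Section Spectrum.
Variables (R : realType) (n : nat).
Implicit Types (A B D U V X Y P Q : 'M[R]_n) (x y z w : 'rV[R]_n).

Lemma le0_of_le_small (a c : R) : 0 <= c -> (forall t, 0 < t -> a <= c * t) -> a <= 0.
Proof.
move=> c0 H; rewrite leNgt; apply/negP => a0.
have c1 : 0 < c + 1 by lra.
have t0 : 0 < a / 2 / (c + 1) by rewrite !divr_gt0.
have := H _ t0; rewrite mulrA ler_pdivlMr// => ac.
by have := mulr_ge0 (ltW a0) c0; lra.
Qed.

(* First-order optimality: moving along the Cayley curve of the skew matrix
   [lie Y B] increases the objective at rate [nrm (lie Y B) ^+ 2]. *)
Lemma max_comm (Z : set 'M[R]_n) Y B : symm Y -> symm B ->
  (forall D, Z D -> Y *m D = D *m Y) -> (forall D, Z D -> B *m D = D *m B) ->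
  (forall Q, orthC Z Q -> inner Y (Q *m B *m Q^T) <= inner Y B) -> Y *m B = B *m Y.
Proof.
move=> YS BS YZ BZ maxB; pose A := lie Y B.
have AT : A^T = - A.
  move: YS BS; rewrite /symm /= /A lieE linearB /= !trmx_mul => -> ->.
  by rewrite opprB.
have [K K0 HK] := conj_expand AT.
apply/eqP; rewrite -subr_eq0 -lieE -/A; apply/eqP/inner_eq0/eqP.
rewrite eq_le inner_ge0 andbT.
apply: (@le0_of_le_small _ (nrm Y * K * nrm B)) => [|t t0].
  by rewrite !mulr_ge0 ?nrm_ge0.
have [C [CO CC /(_ B)[_ CB _]]] := HK _ t0.
(* The curve stays in the group: [A] commutes with [Z] because [Y] and [B] do, and [C] commutes with
   whatever [A] does. *)
have ZC : orthC Z C.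
  split=> // D ZD; apply: CC; rewrite /A !lieE mulmxBl mulmxBr.
  congr (_ - _).
    by rewrite -(mulmxA Y B D) (BZ _ ZD) (mulmxA Y D B) (YZ _ ZD) -(mulmxA D Y B).
  by rewrite -(mulmxA B Y D) (YZ _ ZD) (mulmxA B D Y) (BZ _ ZD) -(mulmxA D B Y).
have := maxB _ ZC; set E := (C *m B *m C^T - B - t *: lie A B) in CB *.
rewrite (_ : C *m B *m C^T = E + B + t *: lie A B); last first.
  by rewrite /E addrAC subrK subrK.
rewrite innerDr innerDr innerZr inner_lie// -/A => H.
have HE : - inner Y E <= nrm Y * (K * t ^+ 2 * nrm B).
  rewrite -innerNr; apply: le_trans (inner_le _ _) _.
  by rewrite nrmN ler_wpM2l ?nrm_ge0.
have : t * inner A A <= t * (nrm Y * K * nrm B * t).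
  apply: (@le_trans _ _ (nrm Y * (K * t ^+ 2 * nrm B))).
    by clearbody E A; move: H HE; lra.
  by rewrite expr2 le_eqVlt; apply/orP; left; apply/eqP; ring.
by rewrite ler_pM2l.
Qed.

Lemma diag_comm_eq0 y B i j : diag_mx y *m B = B *m diag_mx y ->
  y ord0 i != y ord0 j -> B i j = 0.
Proof.
move=> /matrixP/(_ i j); rewrite mul_diag_mx mul_mx_diag !mxE => /eqP.
by rewrite mulrC -subr_eq0 -mulrBr mulf_eq0 subr_eq0 => /orP[/eqP//|->].
Qed.

Lemma tperm_conj (i j : 'I_n) x : tperm_mx i j *m diag_mx x *m (tperm_mx i j)^T =
  diag_mx (\row_k x ord0 (tperm i j k)).
Proof.
rewrite tr_tperm_mx -xcolE -xrowE; apply/matrixP => k l; rewrite !mxE.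
by rewrite (inj_eq perm_inj); case: eqP => // ->; rewrite !mulr1n.
Qed.

Lemma orthogonal_tperm (i j : 'I_n) : orthogonal (tperm_mx i j : 'M[R]_n).
Proof.
rewrite /orthogonal tr_tperm_mx /tperm_mx -perm_mxM -perm_mx1.
by congr perm_mx; exact: tperm2.
Qed.

Lemma tperm_comm (i j : 'I_n) x : x ord0 i = x ord0 j ->
  tperm_mx i j *m diag_mx x = diag_mx x *m tperm_mx i j.
Proof.
move=> xij; have := tperm_conj i j x.
rewrite (_ : \row_k _ = x); last first.
  by apply/rowP => k; rewrite mxE; case: tpermP => // ->.
move=> /(congr1 (fun M => M *m tperm_mx i j)).
by rewrite -!mulmxA orthogonal_tperm mulmx1.
Qed.

Lemma inner_tperm y w (i j : 'I_n) :
  inner y (\row_k w ord0 (tperm i j k)) =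
  inner y w + (y ord0 i - y ord0 j) * (w ord0 j - w ord0 i).
Proof.
have [->|ij] := eqVneq i j.
  rewrite subrr mul0r addr0; congr inner; apply/rowP => k.
  by rewrite mxE tperm1 perm1.
rewrite !innerE !big_ord1 (bigD1 i)//= (bigD1 j)//=; last by rewrite eq_sym.
rewrite [in RHS](bigD1 i)//= [in RHS](bigD1 j)//=; last by rewrite eq_sym.
rewrite !mxE tpermL tpermR.
rewrite (_ : \sum_(_ < n | _) _ = \sum_(k < n | (k != i) && (k != j)) y ord0 k * w ord0 k).
  by ring.
apply: eq_bigr => k /andP[ki kj]; rewrite mxE tpermD// eq_sym//.
Qed.

(** Exchange argument: the transposition changes the pairing by a product of two gaps, one of [y]
    and one of [w]. *)
Lemma inner_tperm_le y w (i j : 'I_n) : y ord0 j < y ord0 i ->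
  inner y (\row_k w ord0 (tperm i j k)) <= inner y w -> w ord0 j <= w ord0 i.
Proof.
move=> yij; rewrite inner_tperm -[leRHS]addr0 lerD2l.
by rewrite pmulr_rle0 ?subr_gt0// subr_le0.
Qed.

(* With strictly decreasing weights, a maximizer of [inner (diag_mx wgt)] over a
   conjugation orbit is diagonal with nonincreasing entries. *)
Definition wgt : 'rV[R]_n := \row_i - (i : nat)%:R.

Lemma wgt_lt (i j : 'I_n) : (i < j)%N -> wgt ord0 j < wgt ord0 i.
Proof. by move=> ij; rewrite !mxE ltrN2 ltr_nat. Qed.

Lemma wgt_inj (i j : 'I_n) : i != j -> wgt ord0 i != wgt ord0 j.
Proof. by move=> ij; rewrite !mxE eqr_opp eqr_nat. Qed.

(** Maximality makes [B] commute with [diag_mx y]; a second maximization, with weights [wgt] and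
    over rotations that also commute with [diag_mx y], diagonalizes [B]. An empty [Z] serves the
    spectral theorem and Fan's inequality, a single diagonal matrix their blockwise versions. *)
Lemma joint_diag (Z : set 'M[R]_n) y B : nonincreasing y -> symm B ->
  (forall D, Z D -> exists d, D = diag_mx d) ->
  (forall D, Z D -> B *m D = D *m B) ->
  (forall Q, orthC Z Q -> inner (diag_mx y) (Q *m B *m Q^T) <= inner (diag_mx y) B) ->
  exists P w, [/\ orthC Z P, P *m diag_mx y = diag_mx y *m P,
    B = P *m diag_mx w *m P^T &
    forall i j : 'I_n, (i < j)%N ->
      (forall D, Z D -> tperm_mx i j *m D = D *m tperm_mx i j) ->
      w ord0 j <= w ord0 i].
Proof.
move=> yN BS Zd BZ maxB.
have diagC (d : 'rV[R]_n) D : Z D -> diag_mx d *m D = D *m diag_mx d.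
  by move=> /Zd[e ->]; exact: diag_mxC.
have yB : diag_mx y *m B = B *m diag_mx y.
  by apply: (max_comm (symm_diag y) BS _ BZ maxB) => D; exact: diagC.
pose Z' := Z `|` [set diag_mx y].
have [P [PO PC] maxP] := orth_max Z' (diag_mx wgt) B.
have PZ : orthC Z P by split=> // D ZD; apply: PC; left.
have Py : P *m diag_mx y = diag_mx y *m P by apply: PC; right.
have BZ' D : Z' D -> B *m D = D *m B by move=> [/BZ//|->].
set B1 := P *m B *m P^T in maxP *.
have B1Z D : Z' D -> B1 *m D = D *m B1.
  move=> ZD; rewrite /B1 -!mulmxA (comm_tr PO (PC _ ZD)) (mulmxA B) BZ'// !mulmxA.
  by rewrite PC.
have B1S : symm B1 by exact: symm_conj.
have maxB1 Q : orthC Z' Q -> inner (diag_mx wgt) (Q *m B1 *m Q^T) <= inner (diag_mx wgt) B1.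
  move=> ZQ; have /maxP : orthC Z' (Q *m P) by exact: orthCM.
  by rewrite trmx_mul !mulmxA.
have wB1 : diag_mx wgt *m B1 = B1 *m diag_mx wgt.
  apply: (max_comm (symm_diag _) B1S _ B1Z maxB1) => D [/diagC//|->].
  exact: diag_mxC.
have [w B1E] : exists w, B1 = diag_mx w.
  apply/diag_mxP/is_diag_mxP => i j ij.
  by apply: diag_comm_eq0 wB1 _; exact: wgt_inj.
exists P^T, w; split.
- exact: orthC_tr.
- exact: comm_tr.
- by rewrite -B1E /B1 trmxK !mulmxA PO mul1mx -mulmxA PO mulmx1.
(* Where [y] ties, the transposition commutes with [diag_mx y] and the second maximum orders [w];
   elsewhere the first maximum does. *)
- move=> i j ij Zij; have [yij|yij] := eqVneq (y ord0 i) (y ord0 j).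
    apply: (inner_tperm_le (wgt_lt ij)).
    have /maxB1 : orthC Z' (tperm_mx i j).
      split=> [|D [/Zij//|->]]; first exact: orthogonal_tperm.
      exact: tperm_comm.
    by rewrite B1E tperm_conj !inner_diag_diag.
  have {}yij : y ord0 j < y ord0 i by rewrite lt_neqAle eq_sym yij yN// ltnW.
  apply: (inner_tperm_le yij).
  have : orthC Z (tperm_mx i j *m P) by apply: orthCM => //; split=> //; exact: orthogonal_tperm.
  have TPE : tperm_mx i j *m P *m B *m (tperm_mx i j *m P)^T =
      tperm_mx i j *m B1 *m (tperm_mx i j)^T by rewrite trmx_mul /B1 !mulmxA.
  move=> /maxB; rewrite TPE B1E tperm_conj inner_diag_diag => /le_trans; apply.
  rewrite -inner_diag_diag -B1E /B1 inner_conjr comm_tr// -mulmxA PO mulmx1//.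
Qed.

Lemma char_poly_conj U A : orthogonal U -> char_poly (U *m A *m U^T) = char_poly A.
Proof.
move=> UO; have := UO; rewrite orthogonalP => UO'.
pose u := map_mx (@polyC R) U.
have uT : u^T = map_mx (@polyC R) U^T by apply/matrixP => i j; rewrite !mxE.
have uu : u *m u^T = 1%:M by rewrite uT -map_mxM UO' map_mx1.
rewrite /char_poly (_ : char_poly_mx _ = u *m char_poly_mx A *m u^T).
  rewrite !det_mulmx mulrAC -det_mulmx uu det1 mul1r//.
rewrite /char_poly_mx mulmxBr mulmxBl scalar_mxC -(mulmxA _%:M) uu mulmx1.
by rewrite uT -!map_mxM.
Qed.

(** Equal characteristic polynomials give the same multiset of entries, which has only one
    nonincreasing arrangement. *)
Lemma nonincreasing_spectrum_uniq U x z : nonincreasing x -> nonincreasing z ->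
  orthogonal U -> diag_mx z = U *m diag_mx x *m U^T -> z = x.
Proof.
move=> xN zN UO zE.
have cpE (v : 'rV[R]_n) : char_poly (diag_mx v) =
    \prod_(a <- [seq v ord0 i | i <- enum 'I_n]) ('X - a%:P).
  rewrite char_poly_trig ?diag_mx_is_trig// big_map big_enum /=.
  by apply: eq_bigr => i _; rewrite mxE eqxx.
have srt (v : 'rV[R]_n) : nonincreasing v ->
    sorted >=%O [seq v ord0 i | i <- enum 'I_n].
  move=> vN; rewrite sorted_map.
  have : sorted (relpre val ltn) (enum 'I_n).
    by rewrite -sorted_map val_enum_ord iota_ltn_sorted.
  by apply: sub_sorted => i j /= ij; exact/vN/ltnW.
have := cpE z; rewrite zE char_poly_conj// cpE => /prod_XsubC_eq xz.
have /eq_in_map E : [seq z ord0 i | i <- enum 'I_n] = [seq x ord0 i | i <- enum 'I_n].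
  apply: (sorted_eq ge_trans ge_anti) (srt _ zN) (srt _ xN) _.
  by rewrite perm_sym.
by apply/rowP => i; rewrite E// mem_enum.
Qed.

Lemma lamE U X x : nonincreasing x -> orthogonal U -> X = U *m diag_mx x *m U^T ->
  lam X = x.
Proof.
move=> xN UO XE; apply: xget_unique; first by split=> //; exists U.
move=> z [zN [V [VO VE]]]; apply: (@nonincreasing_spectrum_uniq (V^T *m U)) => //.
  by apply: orthogonalM => //; exact: orthogonal_tr.
by rewrite trmx_mul trmxK !mulmxA -(mulmxA V^T U) -(mulmxA V^T _ U^T) -XE VE conj_orthVK.
Qed.

Lemma lam_spec X : symm X -> nonincreasing (lam X) /\ exists U, On X U.
Proof.
move=> XS.
(* With [y = 0] the maximality hypothesis is trivial, and diagonalization with ordered entries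
   remains. *)
have [||D []|D []||P [w [[PO _] _ XE wN]]] := @joint_diag set0 0 X.
- by move=> i j _; rewrite !mxE.
- exact: XS.
- by move=> Q _; rewrite (_ : diag_mx 0 = 0) ?inner0l//; exact: raddf0.
have {}wN : nonincreasing w.
  move=> i j; rewrite leq_eqVlt => /predU1P[/val_inj->//|ij].
  by apply: wN => // D [].
by have lE := lamE wN PO XE; rewrite /On /= lE; split=> //; exists P.
Qed.

Lemma lam_nonincreasing X : symm X -> nonincreasing (lam X).
Proof. by move=> /lam_spec[]. Qed.

Lemma On_nonempty X : symm X -> exists U, On X U.
Proof. by move=> /lam_spec[]. Qed.

Lemma lam_conj U X : orthogonal U -> symm X -> lam (U *m X *m U^T) = lam X.
Proof.
move=> UO XS; have [V [VO VE]] := On_nonempty XS.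
apply: (@lamE (U *m V)); [exact: lam_nonincreasing|exact: orthogonalM|].
by rewrite [in LHS]VE trmx_mul !mulmxA.
Qed.

Lemma nrm_lam X : symm X -> inner (lam X) (lam X) = inner X X.
Proof.
move=> XS; have [V [VO VE]] := On_nonempty XS.
by rewrite -inner_diag_diag -(inner_orth _ _ VO) -VE.
Qed.

(** At a maximizer over the conjugation orbit of [B], the diagonalizing rotation commutes with
    [diag_mx y], so the maximum is exactly [inner y (lam B)]. *)
Lemma fan_diag y B : nonincreasing y -> symm B ->
  inner (diag_mx y) B <= inner y (lam B).
Proof.
move=> yN BS; have [P [PO PC] maxP] := orth_max set0 (diag_mx y) B.
set B1 := P *m B *m P^T in maxP.
have [||D []|D []|Q ZQ|P1 [w [[P1O _] yP1 B1E wN]]] := @joint_diag set0 y B1.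
- exact: yN.
- exact: symm_conj.
- by have := maxP _ (orthCM ZQ (conj PO PC)); rewrite trmx_mul !mulmxA.
have {}wN : nonincreasing w.
  move=> i j; rewrite leq_eqVlt => /predU1P[/val_inj->//|ij].
  by apply: wN => // D [].
have <- : lam B1 = lam B by exact: lam_conj.
have -> := lamE wN P1O B1E.
have := maxP _ (orthC1 _); rewrite mul1mx trmx1 mulmx1 => /le_trans; apply.
rewrite B1E inner_conjr comm_tr// -mulmxA P1O mulmx1 inner_diag_diag//.
Qed.

Lemma fan A B : symm A -> symm B -> inner A B <= inner (lam A) (lam B).
Proof.
move=> AS BS; have [V [VO VE]] := On_nonempty AS.
rewrite innerC [in leLHS]VE inner_conjr innerC.
have := symm_conj V^T BS; rewrite trmxK => VBS.
apply: le_trans (fan_diag (lam_nonincreasing AS) VBS) _.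
by rewrite -[V in _ *m V]trmxK lam_conj//; exact: orthogonal_tr.
Qed.

(** [lam] preserves the norm, so after expanding the squares only the cross terms are left to Fan's
    inequality. *)
Lemma lam_lipschitz A B : symm A -> symm B -> nrm (lam A - lam B) <= nrm (A - B).
Proof.
move=> AS BS; rewrite -(@ler_pXn2r _ 2) ?nnegrE ?nrm_ge0// !nrm_sqr.
rewrite !(innerBl, innerBr) !nrm_lam// (innerC (lam B)) (innerC B).
by have := fan AS BS; lra.
Qed.

(** Equality case of Fan's inequality: in an eigenbasis of [X], the rotated [Y] is a maximizer
    against [diag_mx (lam X)], so it is diagonalized by a rotation commuting with that matrix. *)
Lemma simultaneous_On X Y : symm X -> symm Y ->
  (forall V, orthogonal V -> inner Y (V *m X *m V^T) <= inner Y X) ->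
  exists2 U, On X U & On Y U.
Proof.
move=> XS YS maxX; have [U0 [U0O U0E]] := On_nonempty XS.
have BS : symm (U0^T *m Y *m U0) by have := symm_conj U0^T YS; rewrite trmxK.
have [||D []|D []|Q [QO _]|P [w [[PO _] xP BE wN]]] :=
    @joint_diag set0 (lam X) (U0^T *m Y *m U0).
- exact: lam_nonincreasing.
- exact: BS.
- have E (A W : 'M[R]_n) : inner A (U0^T *m W *m U0) = inner W (U0 *m A *m U0^T).
    by have := inner_conjr U0^T A W; rewrite trmxK => ->; rewrite innerC.
  rewrite inner_conjr !E -U0E.
  have /maxX : orthogonal (U0 *m Q^T *m U0^T).
    by do !apply: orthogonalM => //; exact: orthogonal_tr.
  rewrite {1}U0E !trmx_mul !trmxK !mulmxA -(mulmxA _ U0^T U0) U0O mulmx1.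
  by rewrite -!mulmxA (mulmxA U0^T U0) U0O mul1mx.
have {}wN : nonincreasing w.
  move=> i j; rewrite leq_eqVlt => /predU1P[/val_inj->//|ij].
  by apply: wN => // D [].
have UO : orthogonal (U0 *m P) by exact: orthogonalM.
have YE : Y = (U0 *m P) *m diag_mx w *m (U0 *m P)^T.
  by rewrite -[LHS](conj_orthK Y U0O) BE trmx_mul !mulmxA.
exists (U0 *m P); split=> //; last by rewrite (lamE wN UO YE).
rewrite trmx_mul !mulmxA -(mulmxA U0) xP mulmxA -(mulmxA _ P).
by have := PO; rewrite orthogonalP => ->; rewrite mulmx1.
Qed.

End Spectrum.

(** * Second-order perturbation of eigenvalues *)

Section Perturbation.
Variables (R : realType) (n : nat).
Implicit Types (A B D H U V X Y P Q : 'M[R]_n) (x y z w v : 'rV[R]_n).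

Definition blk x H : 'M[R]_n :=
  \matrix_(i, j) if x ord0 i == x ord0 j then H i j else 0.

(* The generator of the rotation that diagonalizes [diag_mx x + t *: H] up to
   [x]-blocks at first order; entries inside the blocks vanish as [0^-1 = 0]. *)
Definition skw x H : 'M[R]_n :=
  \matrix_(i, j) (H i j * (x ord0 j - x ord0 i)^-1).

(** [curv_term] in a common eigenbasis. As [0^-1 = 0], pairs inside an eigenvalue block drop out,
    matching the Moore-Penrose inverse. *)
Definition curv x y H : R :=
  \sum_i \sum_j y ord0 i * (H i j ^+ 2 * (x ord0 i - x ord0 j)^-1).

Definition blk_nonincreasing x w := forall i j : 'I_n, (i < j)%N ->
  x ord0 i = x ord0 j -> w ord0 j <= w ord0 i.

Lemma symmE H i j : symm H -> H i j = H j i.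
Proof. by rewrite /symm /= => {1}<-; rewrite mxE. Qed.

Lemma skw_skew x H : symm H -> (skw x H)^T = - skw x H.
Proof.
move=> HS; apply/matrixP => i j; rewrite !mxE (symmE j i HS).
by rewrite -opprB invrN mulrN.
Qed.

Lemma symm_blk x H : symm H -> symm (blk x H).
Proof.
move=> HS; rewrite /symm /=; apply/matrixP => i j; rewrite !mxE eq_sym.
by case: eqP => // _; exact: symmE.
Qed.

Lemma blk_comm x H : blk x H *m diag_mx x = diag_mx x *m blk x H.
Proof.
apply/matrixP => i j; rewrite mul_diag_mx mul_mx_diag !mxE.
by case: eqP => [->|_]; [exact: mulrC|rewrite mul0r mulr0].
Qed.

(** Dividing by eigenvalue gaps inverts the commutator with [diag_mx x] off the blocks; inside them
    that commutator vanishes. *)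
Lemma lie_skw x H : lie (skw x H) (diag_mx x) = H - blk x H.
Proof.
apply/matrixP => i j; rewrite lieE mul_diag_mx mul_mx_diag !mxE.
rewrite (mulrC (x _ _)) -mulrBr; case: eqP => [->|/eqP xij].
  by rewrite subrr mulr0 subrr.
by rewrite -mulrA mulVf ?mulr1 ?subr0// subr_eq0 eq_sym.
Qed.

Lemma inner_diag_blk x y H : inner (diag_mx y) (blk x H) = inner (diag_mx y) H.
Proof.
by rewrite !inner_diag; congr inner; apply/rowP => i; rewrite !mxE eqxx.
Qed.

(** Both products of the commutator contribute equally, whence the factor 2. The generator vanishes
    inside the blocks, so [G] may be [H] or [H - blk x H]. *)
Lemma inner_lie_skw x y H (G : 'M[R]_n) : symm H ->
  (forall i j, x ord0 i != x ord0 j -> G i j = H i j) ->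
  inner (diag_mx y) (lie (skw x H) G) = - 2 * curv x y H.
Proof.
move=> HS GH; rewrite lieE inner_diag innerE big_ord1 /curv mulr_sumr.
apply: eq_bigr => i _; rewrite !mxE -sumrN -big_split /= !mulr_sumr.
apply: eq_bigr => j _; rewrite !mxE.
have [->|xij] := eqVneq (x ord0 i) (x ord0 j).
  by rewrite subrr invr0; ring.
rewrite !GH//; last by rewrite eq_sym.
rewrite (symmE j i HS) -[x ord0 j - _]opprB invrN; ring.
Qed.

Lemma inner_lie_eq0 A y B : A^T = - A -> diag_mx y *m B = B *m diag_mx y ->
  inner (diag_mx y) (lie A B) = 0.
Proof.
move=> AT yB; rewrite inner_lie//; last exact: symm_diag.
by rewrite lieE yB subrr inner0r.
Qed.

Lemma blk_nonincreasing_add x w : nonincreasing x -> blk_nonincreasing x w ->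
  exists2 del : R, 0 < del & forall t, 0 < t -> t < del -> nonincreasing (x + t *: w).
Proof.
(* [F i j] is the gap of [w] relative to that of [x], and zero inside a block. [S] dominates all of
   them, so [t < (S + 1)^-1] keeps different blocks in order. *)
move=> xN wN; pose F (i j : 'I_n) := `|w ord0 i - w ord0 j| * `|x ord0 i - x ord0 j|^-1.
have F0 i j : 0 <= F i j by rewrite mulr_ge0 ?invr_ge0.
pose S := \sum_i \sum_j F i j.
have S0 : 0 <= S by apply: sumr_ge0 => i _; exact: sumr_ge0.
have FS i j : F i j <= S.
  rewrite /S (bigD1 i)//= (bigD1 j)//= -addrA lerDl addr_ge0 ?sumr_ge0// => k _.
  exact: sumr_ge0.
have S1 : 0 < S + 1 by lra.
exists (S + 1)^-1 => [|t t0 tS i j]; first by rewrite invr_gt0.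
rewrite leq_eqVlt => /predU1P[/val_inj->//|ij]; rewrite !mxE.
have [xij|xij] := eqVneq (x ord0 i) (x ord0 j).
  by rewrite xij lerD2l ler_pM2l// wN.
have {}xij : 0 < x ord0 i - x ord0 j.
  by rewrite subr_gt0 lt_neqAle eq_sym xij xN// ltnW.
have tF : t * F i j <= 1.
  apply: (@le_trans _ _ (t * (S + 1))); first by rewrite ler_pM2l//; have := FS i j; lra.
  by rewrite -ler_pdivlMr// mul1r ltW.
have : t * `|w ord0 i - w ord0 j| <= x ord0 i - x ord0 j.
  move: tF; rewrite /F mulrA (gtr0_norm xij) => tF.
  by rewrite -(@ler_pM2r _ (x ord0 i - x ord0 j)^-1) ?invr_gt0// divff ?gt_eqF.
have := ler_norm (- (w ord0 i - w ord0 j)); rewrite normrN.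
move=> /(ler_wpM2l (ltW t0)) H1 H2; lra.
Qed.

(* Then [w] is the directional derivative of [lam] at [diag_mx x] along [H]. *)
Definition frame x H P w := [/\ orthogonal P, P *m diag_mx x = diag_mx x *m P,
  blk x H = P *m diag_mx w *m P^T & blk_nonincreasing x w].

Lemma frame_exists x H : symm H -> exists P w, frame x H P w.
Proof.
move=> HS; have [||D ->|D ->||P [w [[PO PC] _ BE wN]]] :=
    @joint_diag R n [set diag_mx x] 0 (blk x H).
- by move=> i j _; rewrite !mxE.
- exact: symm_blk.
- by exists x.
- exact: blk_comm.
- by move=> Q _; rewrite (_ : diag_mx 0 = 0) ?inner0l//; exact: raddf0.
exists P, w; split=> // [|i j ij xij]; first exact: PC.
by apply: wN => // D ->; exact: tperm_comm.
Qed.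

Lemma conj_frame x v P (t : R) : orthogonal P -> P *m diag_mx x = diag_mx x *m P ->
  P *m diag_mx (x + t *: v) *m P^T = diag_mx x + t *: (P *m diag_mx v *m P^T).
Proof.
rewrite orthogonalP => PO Px.
rewrite diag_mxD diag_mxZ mulmxDr mulmxDl Px -mulmxA PO mulmx1.
by rewrite -scalemxAr -scalemxAl.
Qed.

Lemma frame_lam x H P w Q (t : R) : frame x H P w -> nonincreasing (x + t *: w) ->
  orthogonal Q -> Q *m diag_mx x = diag_mx x *m Q ->
  lam (diag_mx x + t *: (Q *m blk x H *m Q^T)) = x + t *: w.
Proof.
move=> [PO Px BE wN] xwN QO Qx.
have QPO : orthogonal (Q *m P) by exact: orthogonalM.
apply: (lamE xwN QPO); rewrite conj_frame//.
  by rewrite BE trmx_mul !mulmxA.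
by rewrite -[LHS]mulmxA Px [LHS]mulmxA Qx -[LHS]mulmxA.
Qed.

(** For small [t > 0] both vectors are read off from the spectrum of [diag_mx x + t *: blk x H]. *)
Lemma frame_uniq x H P w P' w' : nonincreasing x -> frame x H P w ->
  frame x H P' w' -> w = w'.
Proof.
move=> xN F F'; have [_ _ _ wN] := F; have [_ _ _ wN'] := F'.
have [d d0 Hd] := blk_nonincreasing_add xN wN.
have [d' d0' Hd'] := blk_nonincreasing_add xN wN'.
pose t := Num.min d d' / 2.
have m0 : 0 < Num.min d d' by rewrite lt_min d0.
have t0 : 0 < t by rewrite /t; lra.
have tm : t < Num.min d d' by rewrite /t; lra.
move: tm; rewrite lt_min => /andP[td td'].
have I1 : 1%:M *m diag_mx x = diag_mx x *m 1%:M by rewrite mul1mx mulmx1.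
have := frame_lam F (Hd _ t0 td) (orthogonal1 _ _) I1.
rewrite (frame_lam F' (Hd' _ t0 td') (orthogonal1 _ _) I1) => /addrI.
by move=> /(scalerI (lt0r_neq0 t0)).
Qed.

(** Blockwise Fan inequality: apply the full one to [diag_mx x + t *: (Q *m blk x H *m Q^T)], whose
    spectrum is exactly [x + t *: w] for small [t], and cancel [inner y x]. *)
Lemma inner_frame_le x y H P w Q : nonincreasing x -> nonincreasing y -> symm H ->
  frame x H P w -> orthogonal Q -> Q *m diag_mx x = diag_mx x *m Q ->
  inner (diag_mx y) (Q *m blk x H *m Q^T) <= inner y w.
Proof.
move=> xN yN HS F QO Qx; have [_ _ _ wN] := F.
have [d d0 Hd] := blk_nonincreasing_add xN wN.
have t0 : 0 < d / 2 by lra.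
have td : d / 2 < d by lra.
have := @fan_diag _ _ y (diag_mx x + (d / 2) *: (Q *m blk x H *m Q^T)) yN.
rewrite (frame_lam F (Hd _ t0 td) QO Qx) !innerDr !innerZr inner_diag_diag lerD2l.
rewrite ler_pM2l//; apply; apply: symmD; first exact: symm_diag.
by apply/symmZ/symm_conj/symm_blk.
Qed.

(* Equality in the blockwise Fan inequality forces the blocks of [H] and [y]
   to be simultaneously diagonalizable. *)
Lemma critical_frame x y H P w : nonincreasing x -> nonincreasing y -> symm H ->
  frame x H P w -> inner y w <= inner (diag_mx y) H ->
  exists2 P', frame x H P' w & P' *m diag_mx y = diag_mx y *m P'.
Proof.
move=> xN yN HS F yw; have [||D ->|D ->|Q [QO QC]|P' [w' [[PO PC] Py BE wN]]] :=
    @joint_diag R n [set diag_mx x] y (blk x H).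
- exact: yN.
- exact: symm_blk.
- by exists x.
- exact: blk_comm.
- rewrite inner_diag_blk; apply: le_trans yw; apply: (inner_frame_le xN yN HS F QO).
  exact: QC.
have F' : frame x H P' w'.
  split=> // [|i j ij xij]; first exact: PC.
  by apply: wN => // D ->; exact: tperm_comm.
by exists P' => //; rewrite (frame_uniq xN F F').
Qed.

Lemma nrm_conj_diag P v : orthogonal P -> nrm (P *m diag_mx v *m P^T) = nrm v.
Proof. by move=> PO; rewrite nrm_orth// nrm_diag. Qed.

(** Along [V = C *m P], the commutator of [skw x H] with [diag_mx x] supplies [H] off the blocks,
    and [P] supplies the blocks. Paired with [diag_mx y], simple commutators vanish and the double
    one leaves [- t ^+ 2 * curv x y H]. Uniformity in [v] allows a different [v] for each [t]. *)
Lemma frame_curve x y H P w : symm H -> frame x H P w ->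
  P *m diag_mx y = diag_mx y *m P ->
  exists2 K : R, 0 <= K & forall t, 0 < t -> exists2 V, orthogonal V &
    forall v, nrm (V *m diag_mx (x + t *: v) *m V^T - diag_mx x - t *: H)
        <= K * t ^+ 2 + t * nrm (v - w) /\
      `|inner (diag_mx y) (V *m diag_mx (x + t *: v) *m V^T)
        - inner y x - t * inner y v + t ^+ 2 * curv x y H| <= K * t ^+ 3 * (1 + nrm v).
Proof.
move=> HS [PO Px BE _] Py; have AT := skw_skew x HS; set A := skw x H in AT.
have [K K0 HK] := conj_expand AT.
have [x0 w0 y0] : [/\ 0 <= nrm x, 0 <= nrm w & 0 <= nrm y] by split; exact: nrm_ge0.
exists (K * (nrm x + nrm w) + nrm y * K * (nrm x + 1)).
  by rewrite addr_ge0 ?mulr_ge0 ?addr_ge0.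
move=> t t0; have [C [CO _ HC]] := HK _ t0.
exists (C *m P) => [|v]; first exact: orthogonalM.
pose Bv := P *m diag_mx v *m P^T.
have -> : C *m P *m diag_mx (x + t *: v) *m (C *m P)^T =
    C *m diag_mx x *m C^T + t *: (C *m Bv *m C^T).
  rewrite trmx_mul (_ : _ *m (P^T *m C^T) = C *m (P *m diag_mx (x + t *: v) *m P^T) *m C^T).
    by rewrite conj_frame// mulmxDr mulmxDl -scalemxAr -scalemxAl.
  by rewrite !mulmxA.
have BvN : nrm Bv = nrm v by rewrite nrm_conj_diag.
have v0 := nrm_ge0 v; have tge0 := ltW t0.
have [_ Hx1 Hx2] := HC (diag_mx x); have [_ Hv1 _] := HC Bv.
have [Hb0 _ _] := HC (blk x H).
rewrite nrm_diag in Hx1 Hx2; rewrite BvN in Hv1.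
have bN : nrm (blk x H) = nrm w by rewrite BE nrm_conj_diag.
rewrite bN in Hb0.
have lieA : lie A (diag_mx x) = H - blk x H by exact: lie_skw.
split.
  set E1 := C *m diag_mx x *m C^T - diag_mx x - t *: lie A (diag_mx x) in Hx1.
  set E2 := C *m blk x H *m C^T - blk x H in Hb0.
  rewrite (_ : _ - t *: H = E1 + t *: E2 + t *: (C *m (Bv - blk x H) *m C^T)); last first.
    rewrite /E1 /E2 lieA mulmxBr mulmxBl; mxabel.
  have -> : Bv - blk x H = P *m diag_mx (v - w) *m P^T.
    by rewrite /Bv BE diag_mxB mulmxBr mulmxBl.
  apply: le_trans (nrmD _ _) _; rewrite nrmZ nrm_orth// nrm_conj_diag// gtr0_norm//.
  rewrite lerD2r; apply: le_trans (nrmD _ _) _; rewrite nrmZ gtr0_norm//.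
  apply: (@le_trans _ _ (K * t ^+ 2 * nrm x + t * (K * t * nrm w))).
    by rewrite lerD// ler_wpM2l.
  have : 0 <= nrm y * K * (nrm x + 1) * t ^+ 2.
    by rewrite !mulr_ge0 ?addr_ge0 ?exprn_ge0.
  rewrite !expr2; lra.
set E2 := _ - (t ^+ 2 / 2) *: lie A (lie A (diag_mx x)) in Hx2.
set E1 := _ - t *: lie A Bv in Hv1.
have yBv : diag_mx y *m Bv = Bv *m diag_mx y.
  rewrite /Bv -!mulmxA (comm_tr PO Py) (mulmxA (diag_mx v)) (diag_mxC v) !mulmxA.
  by rewrite Py.
have L1 : inner (diag_mx y) (lie A (diag_mx x)) = 0.
  by apply: inner_lie_eq0 => //; exact: diag_mxC.
have L2 : inner (diag_mx y) (lie A Bv) = 0 by exact: inner_lie_eq0.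
have L3 : inner (diag_mx y) (lie A (lie A (diag_mx x))) = - 2 * curv x y H.
  rewrite lieA; apply: inner_lie_skw => // i j xij.
  by rewrite !mxE (negPf xij) subr0.
have L4 : inner (diag_mx y) Bv = inner y v.
  rewrite /Bv inner_conjr -mulmxA -Py mulmxA.
  by have := PO; rewrite /Defs.orthogonal => ->; rewrite mul1mx inner_diag_diag.
rewrite (_ : _ + _ = inner (diag_mx y) (E2 + t *: E1)); last first.
  rewrite /E1 /E2 !(innerDr, innerNr, innerZr) L1 L2 L3 L4 inner_diag_diag.
  by field.
apply: le_trans (norm_inner_le _ _) _; rewrite nrm_diag.
apply: (@le_trans _ _ (nrm y * (K * t ^+ 3 * nrm x + t * (K * t ^+ 2 * nrm v)))).
  rewrite ler_wpM2l//; apply: le_trans (nrmD _ _) _; rewrite nrmZ gtr0_norm//.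
  by rewrite lerD// ler_wpM2l.
have h1 : 0 <= K * (nrm x + nrm w) * t ^+ 3 * (1 + nrm v).
  by rewrite !mulr_ge0 ?addr_ge0 ?exprn_ge0.
have h2 : 0 <= nrm y * K * t ^+ 3 * (nrm x * nrm v + 1).
  by rewrite !mulr_ge0 ?addr_ge0 ?exprn_ge0 ?mulr_ge0.
rewrite -subr_ge0 (_ : _ - _ = K * (nrm x + nrm w) * t ^+ 3 * (1 + nrm v)
  + nrm y * K * t ^+ 3 * (nrm x * nrm v + 1)); first exact: addr_ge0.
ring.
Qed.

(** The curve of [frame_curve] with [v = w] has spectrum exactly [x + t *: w]; the Lipschitz bound
    for [lam] compares it with [diag_mx x + t *: H']. *)
Lemma lam_expand x H P w : nonincreasing x -> symm H -> frame x H P w ->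
  exists2 K : R, 0 <= K & exists2 del : R, 0 < del &
    forall t, 0 < t -> t < del -> forall H', symm H' ->
      nrm (lam (diag_mx x + t *: H') - x - t *: w) <= K * t ^+ 2 + t * nrm (H' - H).
Proof.
move=> xN HS F; have [PO _ _ wN] := F.
have P0 : P *m diag_mx 0 = diag_mx 0 *m P.
  by rewrite (_ : diag_mx 0 = 0) ?mulmx0 ?mul0mx//; exact: raddf0.
have [K K0 HK] := frame_curve HS F P0.
have [d d0 Hd] := blk_nonincreasing_add xN wN.
exists K => //; exists d => // t t0 td H' HS'.
have [V VO /(_ w)[+ _]] := HK _ t0.
rewrite subrr nrm0 mulr0 addr0; set X' := V *m _ *m V^T => HX.
have X'S : symm X' by apply/symm_conj/symm_diag.
have lX' : lam X' = x + t *: w by apply: lamE VO _ => //; exact: Hd.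
rewrite -addrA -opprD -lX'; apply: le_trans (lam_lipschitz _ _) _ => //.
  by apply: symmD; [exact: symm_diag|exact: symmZ].
rewrite (_ : _ - X' = t *: (H' - H) - (X' - diag_mx x - t *: H)); last first.
  by rewrite scalerBr; apply/matrixP => i j; rewrite !mxE; ring.
by apply: le_trans (nrmB _ _) _; rewrite nrmZ gtr0_norm// addrC lerD2r.
Qed.

(** Fan's inequality tested on one rotation, generated by [- A] so as to undo the off-block part of
    [H]. The commutator with [H] contributes [2 * t ^+ 2 * curv x y H], of which the double
    commutator with [diag_mx x] takes half back. *)
Lemma inner_lam_ge x y H : nonincreasing y -> symm H ->
  exists2 K : R, 0 <= K & forall t, 0 < t -> forall H', symm H' -> nrm (H' - H) <= 1 ->
    inner y x + t * inner (diag_mx y) H' + t ^+ 2 * curv x y H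
      - K * t ^+ 2 * (t + nrm (H' - H)) <= inner y (lam (diag_mx x + t *: H')).
Proof.
move=> yN HS; have AT := skw_skew x HS; set A := skw x H in AT.
have AT' : (- A)^T = - (- A) by rewrite linearN /= AT.
have [K K0 HK] := conj_expand AT'.
have [x0 H0 y0 A0] : [/\ 0 <= nrm x, 0 <= nrm H, 0 <= nrm y & 0 <= nrm A].
  by split; exact: nrm_ge0.
exists (nrm y * K * (nrm x + nrm H + 1) + 2 * nrm y * nrm A).
  by rewrite addr_ge0 ?mulr_ge0 ?addr_ge0.
move=> t t0 H' HS' HH; have [C [CO _ HC]] := HK _ t0.
have MS : symm (diag_mx x + t *: H').
  by apply: symmD; [exact: symm_diag|exact: symmZ].
have := fan_diag yN (symm_conj C MS); rewrite lam_conj//; apply: le_trans.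
rewrite mulmxDr mulmxDl -scalemxAr -scalemxAl.
have [_ _ Hx2] := HC (diag_mx x); have [_ Hv1 _] := HC H'.
rewrite nrm_diag in Hx2.
set E2 := _ - (t ^+ 2 / 2) *: lie _ (lie _ (diag_mx x)) in Hx2.
set E1 := _ - t *: lie _ H' in Hv1.
have -> : C *m diag_mx x *m C^T = E2 + diag_mx x - t *: lie A (diag_mx x)
    + (t ^+ 2 / 2) *: lie A (lie A (diag_mx x)).
  by rewrite /E2 !lieN !lieNr opprK; apply/matrixP => i j; rewrite !mxE; ring.
have -> : C *m H' *m C^T = E1 + H' - t *: lie A H - t *: lie A (H' - H).
  by rewrite /E1 !lieN lieB; apply/matrixP => i j; rewrite !mxE; ring.
have L1 : inner (diag_mx y) (lie A (diag_mx x)) = 0.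
  by apply: inner_lie_eq0 => //; exact: diag_mxC.
have L3 : inner (diag_mx y) (lie A (lie A (diag_mx x))) = - 2 * curv x y H.
  rewrite lie_skw; apply: inner_lie_skw => // i j xij.
  by rewrite !mxE (negPf xij) subr0.
have L4 : inner (diag_mx y) (lie A H) = - 2 * curv x y H by exact: inner_lie_skw.
clearbody E1 E2.
rewrite !(innerDr, innerNr, innerZr) L1 L3 L4 inner_diag_diag.
set h := nrm (H' - H) in HH *.
have h0 : 0 <= h by exact: nrm_ge0.
have b1 : - (nrm y * (K * t ^+ 3 * nrm x)) <= inner (diag_mx y) E2.
  rewrite lerNl -innerNr; apply: le_trans (inner_le _ _) _.
  by rewrite nrmN nrm_diag ler_wpM2l.
have HH' : nrm H' <= nrm H + 1.
  by rewrite -[H'](subrK H) addrC; apply: le_trans (nrmD _ _) _; rewrite lerD2l.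
have b2 : - (nrm y * (K * t ^+ 2 * (nrm H + 1))) <= inner (diag_mx y) E1.
  rewrite lerNl -innerNr; apply: le_trans (inner_le _ _) _.
  rewrite nrmN nrm_diag ler_wpM2l//; apply: le_trans Hv1 _.
  by rewrite ler_wpM2l// mulr_ge0// exprn_ge0// ltW.
have b3 : inner (diag_mx y) (lie A (H' - H)) <= nrm y * (2 * nrm A * h).
  apply: le_trans (inner_le _ _) _; rewrite nrm_diag ler_wpM2l//.
  rewrite lieE; apply: le_trans (nrmB _ _) _.
  by apply: le_trans (lerD (nrmM _ _) (nrmM _ _)) _; rewrite -/h; lra.
have b2t := ler_wpM2l (ltW t0) b2.
have b3t := ler_wpM2l (ltW (exprn_gt0 2 t0)) b3.
have r1 : 0 <= nrm y * K * (nrm x + nrm H + 1) * t ^+ 2 * h.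
  by rewrite !mulr_ge0 ?addr_ge0 ?exprn_ge0// ltW.
have r2 : 0 <= 2 * nrm y * nrm A * t ^+ 2 * t.
  by rewrite !mulr_ge0 ?exprn_ge0// ltW.
rewrite !exprS !expr0 in b1 b2 b3 b2t b3t r1 r2 *.
lra.
Qed.

End Perturbation.

(** * Lower limits and difference quotients *)

Section LowerLimit.
Variable R : realType.
Local Open Scope ereal_scope.

Lemma cvg0_lt (u : nat -> R) (d : R) : u @ \oo --> (0%R : R) -> (0 < d)%R ->
  \forall k \near \oo, (u k < d)%R.
Proof.
move=> /cvgrPdist_lt H /H; apply: filterS => k; rewrite sub0r normrN.
exact: le_lt_trans (ler_norm _).
Qed.

Section OneSpace.
Variables (p q : nat) (E : set 'M[R]_(p, q)) (F : R -> 'M[R]_(p, q) -> \bar R).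
Implicit Types (w : 'M[R]_(p, q)) (c : \bar R).

Lemma liminf_tw_ge w0 c : (exists2 d : R, (0 < d)%R & forall t w, (0 < t)%R -> (t < d)%R ->
  E w -> (nrm (w - w0) < d)%R -> c <= F t w) -> c <= liminf_tw E F w0.
Proof.
move=> [d d0 H]; apply: le_ereal_sup_tmp; eexists; first by exists d.
by apply: le_ereal_inf_tmp => _ [t [t0 td]] [w [Ew wd] <-]; exact: H.
Qed.

Lemma liminf_tw_gt w0 c : c < liminf_tw E F w0 ->
  exists2 d : R, (0 < d)%R & forall t w, (0 < t)%R -> (t < d)%R ->
  E w -> (nrm (w - w0) < d)%R -> c < F t w.
Proof.
move=> /ereal_sup_gt[_ [d d0 <-] cd]; exists d => // t w t0 td Ew wd.
by apply: lt_le_trans cd _; apply: ereal_inf_lbound; exists t => //; exists w.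
Qed.

Lemma liminf_tw_lt w0 c : liminf_tw E F w0 < c ->
  forall d : R, (0 < d)%R -> exists t w, [/\ (0 < t)%R, (t < d)%R, E w,
    (nrm (w - w0) < d)%R & F t w < c].
Proof.
move=> Fc d d0.
have /ereal_inf_lt[_ [t [t0 td]] [w [Ew wd] <-] Ftw] : ereal_inf [set F t w | t in
    [set t : R | (0 < t)%R /\ (t < d)%R] & w in [set w | E w /\ (nrm (w - w0)%R < d)%R]] < c.
  by apply: le_lt_trans Fc; apply: ereal_sup_ubound; exists d.
by exists t, w.
Qed.

Lemma liminf_tw_near w0 (t_ : nat -> R) (w_ : nat -> 'M[R]_(p, q)) c :
  (forall k, (0 < t_ k)%R) -> t_ @ \oo --> (0%R : R) -> (forall k, E (w_ k)) ->
  (fun k => nrm (w_ k - w0)) @ \oo --> (0%R : R) -> c < liminf_tw E F w0 ->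
  \forall k \near \oo, c < F (t_ k) (w_ k).
Proof.
move=> t0 t_0 Ew w_0 /liminf_tw_gt[d d0 H].
have ht := cvg0_lt t_0 d0; have hw := cvg0_lt w_0 d0.
by near=> k; apply: H => //; near: k.
Unshelve. all: by end_near.
Qed.

Lemma liminf_tw_le_lim w0 (t_ : nat -> R) (w_ : nat -> 'M[R]_(p, q)) c :
  (forall k, (0 < t_ k)%R) -> t_ @ \oo --> (0%R : R) -> (forall k, E (w_ k)) ->
  (fun k => nrm (w_ k - w0)) @ \oo --> (0%R : R) ->
  (fun k => F (t_ k) (w_ k)) @ \oo --> c -> liminf_tw E F w0 <= c.
Proof.
move=> t0 t_0 Ew w_0 Fc; apply: ge_ereal_sup => _ [d /= d0 <-].
apply: (cvge_to_ge Fc).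
have ht := cvg0_lt t_0 d0; have hw := cvg0_lt w_0 d0.
near=> k; apply: ereal_inf_lbound; exists (t_ k).
  by split=> //; near: k.
by exists (w_ k) => //; split=> //; near: k.
Unshelve. all: by end_near.
Qed.

End OneSpace.

Section TwoSpaces.
Variables (p q p' q' : nat) (E : set 'M[R]_(p, q)) (F : R -> 'M[R]_(p, q) -> \bar R)
  (w0 : 'M[R]_(p, q)) (E' : set 'M[R]_(p', q')) (F' : R -> 'M[R]_(p', q') -> \bar R)
  (w0' : 'M[R]_(p', q')).

(** Each point near [w0] has a partner at the same [t] whose value is lower by at least [c - e].
    Real bounds [r] below the left lower limit keep infinities out of the estimate. *)
Lemma liminf_tw_transfer (c : R) :
  (forall d e : R, (0 < d)%R -> (0 < e)%R -> exists2 d' : R, (0 < d')%R &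
    forall t w, (0 < t)%R -> (t < d')%R -> E w -> (nrm (w - w0) < d')%R ->
    exists w', [/\ E' w', (nrm (w' - w0') < d)%R, (t < d)%R
      & F' t w' + (c - e)%:E <= F t w]) ->
  liminf_tw E' F' w0' + c%:E <= liminf_tw E F w0.
Proof.
move=> H; have step (r e : R) : (0 < e)%R -> r%:E < liminf_tw E' F' w0' ->
    (r + (c - e))%:E <= liminf_tw E F w0.
  move=> e0 /liminf_tw_gt[d d0 Hd]; have [d' d'0 Hd'] := H _ _ d0 e0.
  apply: liminf_tw_ge; exists d' => // t w t0 td Ew wd.
  have [w' [Ew' wd' td' le]] := Hd' _ _ t0 td Ew wd.
  by apply: le_trans le; rewrite EFinD leeD2r// ltW// Hd.
case L : (liminf_tw E' F' w0') step => [l| |] step; last by rewrite addNye leNye.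
  apply/lee_addgt0Pr => e e0; have e2 : (0 < e / 2)%R by rewrite divr_gt0.
  have /(step (l - e / 2)%R _ e2) : (l - e / 2)%R%:E < l%:E by rewrite lte_fin ltrBlDr ltrDl.
  move=> /(leeD2r e%:E); apply: le_trans; rewrite -!EFinD lee_fin; lra.
rewrite addye//; case G : (liminf_tw E F w0) step => [m| |] step //; last first.
  by have := step 0%R 1%R ltr01 (ltry _).
by have := step (m - c + 2)%R 1%R ltr01 (ltry _); rewrite lee_fin => h; exfalso; clear L G; lra.
Qed.

Lemma liminf_tw_le_map :
  (forall t w, (0 < t)%R -> E w -> exists w', [/\ E' w',
    (nrm (w' - w0') <= nrm (w - w0))%R & F' t w' <= F t w]) ->
  liminf_tw E' F' w0' <= liminf_tw E F w0.
Proof.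
move=> H; rewrite -[leLHS]adde0; apply: (@liminf_tw_transfer 0%R) => d e d0 e0.
exists d => // t w t0 td Ew wd; have [w' [Ew' ww' le]] := H _ _ t0 Ew.
exists w'; split=> //; first exact: le_lt_trans wd.
by rewrite -[leRHS]adde0 leeD// lee_fin; lra.
Qed.

End TwoSpaces.

Lemma quot_le (a a' : \bar R) (b r c : R) : (0 <= c)%R -> a <= a' ->
  (a - b%:E - r%:E) * c%:E <= (a' - b%:E - r%:E) * c%:E.
Proof. by move=> c0 aa'; rewrite lee_wpmul2r ?lee_fin// !leeD2r. Qed.

(** Exchanges the linear term of a difference quotient; positivity of [c] makes this valid for
    infinite [a] too. *)
Lemma quot_shift (a : \bar R) (b r1 r2 c : R) : (0 < c)%R ->
  (a - b%:E - r2%:E) * c%:E = (a - b%:E - r1%:E) * c%:E + ((r1 - r2) * c)%:E.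
Proof.
move=> c0; case: a => [a| |].
- by rewrite -!EFinB -!EFinM -EFinD; congr (_%:E); ring.
- by rewrite !addye// gt0_mulye ?lte_fin// addye.
- by rewrite !addNye gt0_mulNye ?lte_fin// addNye.
Qed.

Lemma half_sqr_inv_gt0 (t : R) : (0 < t)%R -> (0 < (2^-1 * t ^+ 2)^-1)%R.
Proof. by move=> t0; rewrite invr_gt0 mulr_gt0 ?invr_gt0// exprn_gt0. Qed.

Section Subgradient.
Variables (p q : nat) (E : set 'M[R]_(p, q)) (f : 'M[R]_(p, q) -> \bar R).
Variables (x v : 'M[R]_(p, q)).
Hypothesis vx : subdiff E f x v.
Hypothesis Edir : forall t w, E w -> E (x + t *: w)%R.

Lemma dq2_ge0 t w : (0 < t)%R -> E w -> 0 <= dq2 f x v t w.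
Proof.
move=> t0 Ew; have [_ [fx /(_ _ (Edir t Ew))]] := vx.
rewrite addrAC subrr add0r innerZr /dq2 -(fineK fx); set b := fine (f x) => H.
apply: mule_ge0; last by rewrite lee_fin ltW// half_sqr_inv_gt0.
by rewrite leeBrDr// leeBrDr// add0e addeC.
Qed.

Lemma second_subderiv_ge0 w : 0 <= second_subderiv E f x v w.
Proof.
by apply: liminf_tw_ge; exists 1%R => // t w' t0 _ Ew' _; exact: dq2_ge0.
Qed.

End Subgradient.

(** Upper control comes from the sequence [v], lower control from a lower-limit condition. *)
Lemma cvge_squeeze_below (u v : nat -> \bar R) (l : R) :
  (forall k, u k <= v k) -> v @ \oo --> l%:E ->
  (forall c : \bar R, c < l%:E -> \forall k \near \oo, c < u k) -> u @ \oo --> l%:E.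
Proof.
move=> uv /fine_cvgP[vfin vl] lu.
have lb (e : R) : (0 < e)%R -> \forall k \near \oo, (l - e)%:E < u k.
  by move=> e0; apply: lu; rewrite lte_fin ltrBlDr ltrDl.
have ufin : \forall k \near \oo, u k \is a fin_num.
  near=> k; rewrite fin_numE gt_eqF ?lt_eqF//.
    apply: le_lt_trans (uv k) _; rewrite ltey_eq.
    by apply/orP; left; near: k.
  by apply: lt_trans (ltNyr (l - 1)) _; near: k; exact: lb.
apply/fine_cvgP; split=> //; apply/cvgrPdist_lt => e e0.
have /cvgrPdist_lt/(_ _ e0) vle := vl.
near=> k.
have ukfin : u k \is a fin_num by near: k.
have vkfin : v k \is a fin_num by near: k.
have : (l - e)%:E < u k by near: k; exact: lb.
have := uv k; rewrite -(fineK ukfin) -(fineK vkfin) lee_fin lte_fin /=.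
have : (`|l - (fine \o v) k| < e)%R by near: k.
rewrite /= !ltr_norml => /andP[h1 h2] h3 h4; apply/andP; split; lra.
Unshelve. all: by end_near.
Qed.

End LowerLimit.

(** * Spectral functions *)

Section MoorePenrose.
Variables (R : realType) (n : nat).
Implicit Types (A B C H U X Y : 'M[R]_n).

Lemma mpinv_unique A B C :
  [/\ A *m B *m A = A, B *m A *m B = B, (A *m B)^T = A *m B & (B *m A)^T = B *m A] ->
  [/\ A *m C *m A = A, C *m A *m C = C, (A *m C)^T = A *m C & (C *m A)^T = C *m A] ->
  B = C.
Proof.
move=> [ABA BAB ABT BAT] [ACA CAC ACT CAT].
have AB_AC : A *m B = A *m C.
  rewrite -{1}ABT -{1}ACA -(mulmxA (A *m C)) trmx_mul ACT ABT.
  by rewrite mulmxA ABA.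
have BA_CA : B *m A = C *m A.
  rewrite -{1}BAT -{1}ACA -(mulmxA A) (mulmxA B) trmx_mul CAT BAT.
  by rewrite -mulmxA (mulmxA A) ABA.
by rewrite -BAB BA_CA -mulmxA AB_AC mulmxA CAC.
Qed.

(** Everything is diagonal in the eigenbasis, where [0^-1 = 0] is exactly the Moore-Penrose
    convention on the kernel. *)
Lemma mpinv_On X U (mu : R) : On X U -> mpinv (mu%:M - X) =
  U *m diag_mx (\row_j (mu - lam X ord0 j)^-1) *m U^T.
Proof.
move=> [UO XE]; set D := diag_mx (\row_j (mu - lam X ord0 j)^-1).
pose G := diag_mx (\row_j (mu - lam X ord0 j)).
have AE : mu%:M - X = U *m G *m U^T.
  have := UO; rewrite orthogonalP => UO'.
  rewrite {1}XE (_ : G = mu%:M - diag_mx (lam X)); last first.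
    by apply/matrixP => i j; rewrite !mxE; case: eqP => _; rewrite ?mulr1n ?mulr0n ?subr0.
  by rewrite mulmxBr mulmxBl mul_mx_scalar -scalemxAl UO' scalemx1.
have conjM (A B : 'M[R]_n) : (U *m A *m U^T) *m (U *m B *m U^T) = U *m (A *m B) *m U^T.
  by rewrite !mulmxA -(mulmxA _ U^T U) UO mulmx1.
have GD : G *m D = diag_mx (\row_j ((mu - lam X ord0 j) * (mu - lam X ord0 j)^-1)).
  by rewrite mulmx_diag; congr diag_mx; apply/rowP => j; rewrite !mxE.
have DG : D *m G = G *m D by exact: diag_mxC.
have GDG : G *m D *m G = G.
  rewrite GD mulmx_diag; congr diag_mx; apply/rowP => j; rewrite !mxE.
  by have [->|h] := eqVneq (mu - lam X ord0 j) 0; rewrite ?mulr0// divff// mul1r.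
have DGD : D *m G *m D = D.
  rewrite DG GD mulmx_diag; congr diag_mx; apply/rowP => j; rewrite !mxE.
  by have [->|h] := eqVneq (mu - lam X ord0 j) 0; rewrite ?invr0 ?mulr0// divff// mul1r.
have mpD : [/\ (mu%:M - X) *m (U *m D *m U^T) *m (mu%:M - X) = mu%:M - X,
    U *m D *m U^T *m (mu%:M - X) *m (U *m D *m U^T) = U *m D *m U^T,
    ((mu%:M - X) *m (U *m D *m U^T))^T = (mu%:M - X) *m (U *m D *m U^T) &
    (U *m D *m U^T *m (mu%:M - X))^T = U *m D *m U^T *m (mu%:M - X)].
  rewrite AE !conjM DGD GDG DG GD; split=> //;
    by apply: symm_conj; exact: symm_diag.
by apply: xget_unique => // B mpB; exact: mpinv_unique mpB mpD.
Qed.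

Lemma conj_diag_entry H (d : 'rV[R]_n) i : symm H ->
  (H *m diag_mx d *m H) i i = \sum_j H i j ^+ 2 * d ord0 j.
Proof.
move=> HS; rewrite mxE; apply: eq_bigr => j _; rewrite mul_mx_diag mxE.
by rewrite (symmE j i HS); ring.
Qed.

Lemma curv_termE X Y U H : On X U -> symm H ->
  curv_term X Y U H = curv (lam X) (lam Y) (U^T *m H *m U).
Proof.
move=> XU HS; have [UO _] := XU; set x := lam X; set y := lam Y.
set h := U^T *m H *m U.
have hS : symm h by have := symm_conj U^T HS; rewrite trmxK.
pose F i := \sum_j y ord0 i * (h i j ^+ 2 * (x ord0 i - x ord0 j)^-1).
have blockE (mu : R) (i : 'I_n) : x ord0 i = mu ->
    \sum_(j | x ord0 j == mu) diag_mx y i j *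
      (U^T *m H *m mpinv (mu%:M - X) *m H *m U) i j = F i.
  move=> xi; rewrite (bigD1 i) ?xi//= big1 ?addr0 => [|j /andP[_ ji]]; last first.
    by rewrite mxE eq_sym (negPf ji) mul0r.
  rewrite mxE eqxx mulr1n /F -mulr_sumr; congr (_ * _).
  rewrite (mpinv_On mu XU) !mulmxA -/h -(mulmxA _ U^T) -(mulmxA _ _ U) -/h.
  by rewrite conj_diag_entry//; apply: eq_bigr => j _; congr (_ * _); rewrite mxE -/x xi.
rewrite /curv_term -/x -/y.
under eq_bigr => mu _.
  under eq_bigr => i /eqP xi do rewrite (blockE _ _ xi).
  rewrite big_mkcond; over.
(* Every index has exactly one eigenvalue in the duplicate-free list, so the sum over blocks is a
   sum over all indices. *)
rewrite exchange_big /curv; apply: eq_bigr => i _ /=.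
rewrite (bigD1_seq (x ord0 i)) ?undup_uniq//=; last first.
  by rewrite mem_undup; apply/mapP; exists i; rewrite ?mem_enum.
rewrite eqxx big1 ?addr0// => mu; rewrite eq_sym => /negPf ->.
by [].
Qed.

End MoorePenrose.

(** * Transfer between [g] and its restriction [theta] to diagonal matrices *)

Section Spectral.
Variables (R : realType) (n : nat).
Variables (g : 'M[R]_n -> \bar R) (theta : 'rV[R]_n -> \bar R).
Hypothesis g_spectral : forall X : 'M[R]_n, symm X -> g X = theta (lam X).
Hypothesis theta_diag : forall x : 'rV[R]_n, theta x = g (diag_mx x).
Implicit Types (A B H U V X Y Z P : 'M[R]_n) (x y z w v : 'rV[R]_n).

Lemma spectral_conj U A : orthogonal U -> symm A -> g (U *m A *m U^T) = g A.
Proof.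
by move=> UO AS; rewrite g_spectral ?lam_conj -?g_spectral//; exact: symm_conj.
Qed.

Lemma spectral_conj_diag U x : orthogonal U -> g (U *m diag_mx x *m U^T) = theta x.
Proof. by move=> UO; rewrite spectral_conj -?theta_diag//; exact: symm_diag. Qed.

Lemma symm_dir X : symm X -> forall (t : R) W, symm W -> symm (X + t *: W).
Proof. by move=> XS t W WS; apply: symmD => //; exact: symmZ. Qed.

Lemma conj_dir U x (t : R) H : orthogonal U ->
  U *m (diag_mx x + t *: (U^T *m H *m U)) *m U^T = U *m diag_mx x *m U^T + t *: H.
Proof.
by move=> UO; rewrite mulmxDr mulmxDl -scalemxAr -scalemxAl conj_orthK.
Qed.

Section Convex.
Hypothesis g_convex : convex_fun (@symm R n) g.

(** Interpolates from [Z] at [k = 0] to its diagonal at [k = n]. *)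
Definition pinch (k : nat) Z : 'M[R]_n := \matrix_(i, j)
  if (i == j) || ((k <= i)%N && (k <= j)%N) then Z i j else 0.

Lemma symm_pinch k Z : symm Z -> symm (pinch k Z).
Proof.
move=> ZS; rewrite /symm /=; apply/matrixP => i j; rewrite !mxE eq_sym andbC.
by case: ifP => // _; exact: symmE.
Qed.

(* Averaging with the conjugate by the reflection in the [k]-th coordinate
   kills the off-diagonal entries of the [k]-th row and column. *)
Lemma pinch_step k Z : symm Z -> (k < n)%N ->
  (g (pinch k.+1 Z) <= g (pinch k Z))%E.
Proof.
move=> ZS kn; pose S : 'M[R]_n := diag_mx (\row_i (if (i : nat) == k then -1 else 1)).
have ST : S^T = S by exact: tr_diag_mx.
have SO : orthogonal S.
  rewrite /Defs.orthogonal ST mulmx_diag -diag_const_mx; congr diag_mx.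
  by apply/rowP => i; rewrite !mxE; case: eqP => _; ring.
have PS := symm_pinch k ZS.
have := g_convex PS (symm_conj S PS) (t := 2^-1).
rewrite spectral_conj// (_ : 2^-1 *: pinch k Z + _ = pinch k.+1 Z); last first.
  apply/matrixP => i j; rewrite ST mul_mx_diag mul_diag_mx !mxE.
  have [->|ij] := eqVneq i j; first by case: eqP => _ /=; field.
  rewrite /= -val_eqE /= in ij *.
  case: (ltngtP k i) => [ki|ki|ki]; case: (ltngtP k j) => [kj|kj|kj] /=;
    by first [field | move: ij; rewrite -ki -kj eqxx].
have half : 0 <= 2^-1 :> R by rewrite invr_ge0.
have half1 : 2^-1 <= 1 :> R by rewrite invf_le1// ler1n.
move=> /(_ half half1) /le_trans; apply.
have -> : 1 - 2^-1 = 2^-1 :> R by field.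
case: (g (pinch k Z)) => [r| |].
- by rewrite -EFinM -EFinD lee_fin le_eqVlt; apply/orP; left; apply/eqP; field.
- by rewrite leey.
- by rewrite gt0_muleNy// lte_fin invr_gt0.
Qed.

Lemma theta_diag_le Z : symm Z -> (theta (\row_i Z i i) <= g Z)%E.
Proof.
move=> ZS; have H k : (k <= n)%N -> (g (pinch k Z) <= g Z)%E.
  elim: k => [_|k IH kn]; last exact: le_trans (pinch_step ZS kn) (IH (ltnW kn)).
  rewrite (_ : pinch 0 Z = Z)//; apply/matrixP => i j; rewrite !mxE.
  by rewrite !leq0n orbT.
have := H n (leqnn n); rewrite theta_diag (_ : pinch n Z = diag_mx (\row_i Z i i))//.
apply/matrixP => i j; rewrite !mxE leqNgt ltn_ord /= orbF.
by case: eqP => [->|_]; rewrite ?mulr1n ?mulr0n.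
Qed.

(** * Part (b): parabolic regularity passes from [g] to [theta] *)

Section PartB.
Variables (X U : 'M[R]_n) (v : 'rV[R]_n).
Hypotheses (XS : symm X) (XU : On X U) (vx : subdiff setT theta (lam X) v).

Let V := U *m diag_mx v *m U^T.
(** A linear, norm-nonincreasing left inverse of the embedding of [w] as [U *m diag_mx w *m U^T];
    the two maps carry test points between the spaces. *)
Let dg H : 'rV[R]_n := \row_i (U^T *m H *m U) i i.

Let UO : orthogonal U. Proof. by case: XU. Qed.
Let gX : g X = theta (lam X). Proof. exact: g_spectral. Qed.

Let inner_V H : inner V H = inner v (dg H).
Proof.
rewrite /V innerC inner_conjr innerC inner_diag//.
Qed.

Let dg_X : dg X = lam X.
Proof.
case: XU => _ XE; apply/rowP => i; rewrite /dg {1}XE conj_orthVK//.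
by rewrite !mxE eqxx.
Qed.

Let dgD A B (t : R) : dg (A + t *: B) = dg A + t *: dg B.
Proof.
apply/rowP => i; rewrite /dg mulmxDr mulmxDl -scalemxAr -scalemxAl.
by rewrite !mxE.
Qed.

Let dg_diag w : dg (U *m diag_mx w *m U^T) = w.
Proof. by apply/rowP => i; rewrite /dg conj_orthVK// !mxE eqxx. Qed.

Let nrm_dg H : nrm (dg H) <= nrm H.
Proof.
have -> : nrm H = nrm (U^T *m H *m U).
  by rewrite -[U in _ *m U]trmxK nrm_orth//; exact: orthogonal_tr.
rewrite -(@ler_pXn2r _ 2) ?nnegrE ?nrm_ge0// !nrm_sqr !innerE big_ord1.
apply: ler_sum => i _; rewrite (bigD1 i)//= !mxE lerDl.
by apply: sumr_ge0 => j _; rewrite -expr2 sqr_ge0.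
Qed.

Let theta_dg_le H : symm H -> (theta (dg H) <= g H)%E.
Proof.
move=> HS; have UHS : symm (U^T *m H *m U) by have := symm_conj U^T HS; rewrite trmxK.
rewrite -[in leRHS](conj_orthK H UO) spectral_conj//; exact: theta_diag_le.
Qed.

Let dq2_dg (t : R) H : 0 < t -> symm H ->
  (dq2 theta (lam X) v t (dg H) <= dq2 g X V t H)%E.
Proof.
move=> t0 HS; rewrite /dq2 inner_V gX; have [_ [/fineK <- _]] := vx.
apply: quot_le; first exact/ltW/half_sqr_inv_gt0.
rewrite -dg_X -dgD; apply: theta_dg_le; exact: symm_dir.
Qed.

Let dq2_diag (t : R) w :
  dq2 g X V t (U *m diag_mx w *m U^T) = dq2 theta (lam X) v t w.
Proof.
rewrite /dq2 inner_V dg_diag gX (_ : X + _ = U *m diag_mx (lam X + t *: w) *m U^T).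
  by rewrite spectral_conj_diag.
case: XU => _ {1}->; rewrite diag_mxD diag_mxZ mulmxDr mulmxDl.
by rewrite -scalemxAr -scalemxAl.
Qed.

Let subdiff_V : subdiff (@symm R n) g X V.
Proof.
have [_ [thx H]] := vx; split; first exact/symm_conj/symm_diag.
split=> [|Z ZS]; first by rewrite gX.
apply: le_trans (theta_dg_le ZS); rewrite gX inner_V.
have := H (dg Z) I; rewrite (_ : dg (Z - X) = dg Z - lam X)//.
by rewrite -scaleN1r dgD scaleN1r dg_X.
Qed.

Lemma theta_parab_regular_for : parab_regular (@symm R n) g X ->
  parab_regular_for setT theta (lam X) v.
Proof.
move=> /(_ V subdiff_V) reg w _ dw.
have WS : symm (U *m diag_mx w *m U^T) by exact/symm_conj/symm_diag.
have dg_near H : nrm (dg H - w) <= nrm (H - U *m diag_mx w *m U^T).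
  rewrite -[X in dg _ - X]dg_diag -scaleN1r -dgD scaleN1r; exact: nrm_dg.
(* The diagonal embedding gives one inequality, the projection [dg] the other. *)
have dE : second_subderiv (@symm R n) g X V (U *m diag_mx w *m U^T) =
    second_subderiv setT theta (lam X) v w.
  apply/eqP; rewrite eq_le; apply/andP; split; apply: liminf_tw_le_map.
    move=> t z t0 _; exists (U *m diag_mx z *m U^T); split.
    - exact/symm_conj/symm_diag.
    - by rewrite -mulmxBl -mulmxBr -diag_mxB nrm_conj_diag.
    - by rewrite dq2_diag.
  by move=> t H t0 HS; exists (dg H); split=> //; exact: dq2_dg.
have [|t_ [H_ [[t0 t_0 HS H_w cvH] [M HM]]]] := reg _ WS; first by rewrite dE.
exists t_, (fun k => dg (H_ k)); split; last first.
  exists M => k; apply: le_trans (HM k); rewrite ler_pM2r ?invr_gt0//; exact: dg_near.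
have dg_w : (fun k => nrm (dg (H_ k) - w)) @ \oo --> (0 : R).
  apply: (squeeze_cvgr _ (@cvg_cst _ (0 : R) _ _ _) H_w); apply: nearW => k.
  by rewrite nrm_ge0 dg_near.
split=> //; rewrite dE in cvH.
(* Second-order quotients at a subgradient are nonnegative, so the limit is a real number and
   squeezing applies. *)
have dfin : second_subderiv setT theta (lam X) v w \is a fin_num.
  rewrite ge0_fin_numE//; apply: second_subderiv_ge0 vx _ _ => t z _.
  by [].
rewrite -(fineK dfin) in cvH *; apply: cvge_squeeze_below cvH _ => [k|c].
  exact: dq2_dg.
by rewrite fineK// => /(liminf_tw_near t0 t_0 _ dg_w); apply.
Qed.

End PartB.
End Convex.

(** * Part (a): parabolic regularity and second subderivatives pass from [theta] to [g] *)

Section PartA.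
Variables (X Y : 'M[R]_n).
Hypotheses (XS : symm X) (YX : subdiff (@symm R n) g X Y).

Let YS : symm Y. Proof. by case: YX. Qed.
Let gXfin : g X \is a fin_num. Proof. by case: YX => _ []. Qed.

(** The subgradient inequality at [V *m X *m V^T], where [g] still equals [g X], shows that [X]
    maximizes the pairing with [Y] over its orbit. *)
Lemma subdiff_On : exists2 U, On X U & On Y U.
Proof.
apply: simultaneous_On => // V VO; have [_ [_ /(_ _ (symm_conj V XS))]] := YX.
rewrite spectral_conj// -[in X in (_ <= X)%E](fineK gXfin) -[in leLHS](fineK gXfin).
by rewrite -EFinD lee_fin gerDl innerBr subr_le0.
Qed.

Section Frame.
Variable U : 'M[R]_n.
Hypotheses (XU : On X U) (YU : On Y U).

Let x := lam X.
Let y := lam Y.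
Let rot H := U^T *m H *m U.
Let UO : orthogonal U. Proof. by case: XU. Qed.
Let xN : nonincreasing x. Proof. exact: lam_nonincreasing. Qed.
Let yN : nonincreasing y. Proof. exact: lam_nonincreasing. Qed.
Let gX : g X = theta x. Proof. exact: g_spectral. Qed.
Let b := fine (g X).
Let gXb : g X = b%:E. Proof. by rewrite fineK. Qed.

Let rotS H : symm H -> symm (rot H).
Proof. by move=> HS; have := symm_conj U^T HS; rewrite trmxK. Qed.

Let rotB H H' : rot H' - rot H = rot (H' - H).
Proof. by rewrite /rot mulmxBr mulmxBl. Qed.

Let nrm_rot H : nrm (rot H) = nrm H.
Proof.
by rewrite /rot -[U in _ *m U]trmxK nrm_orth//; exact: orthogonal_tr.
Qed.

Let inner_rot H : inner Y H = inner (diag_mx y) (rot H).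
Proof. by case: YU => _ {1}->; rewrite innerC inner_conjr innerC. Qed.

Let lam_rot (t : R) H : symm H -> lam (X + t *: H) = lam (diag_mx x + t *: rot H).
Proof.
move=> HS; rewrite -[RHS](lam_conj UO) ?conj_dir//; first by case: XU => _ <-.
by apply: symm_dir; [exact: symm_diag|exact: rotS].
Qed.

(** The subgradient inequality of [g], tested on the matrices [U *m diag_mx z *m U^T]. *)
Let theta_sub : subdiff setT theta x y.
Proof.
split=> //; rewrite -gX; split=> // z _; have [_ [_ H]] := YX.
have := H _ (symm_conj U (symm_diag z)); rewrite spectral_conj_diag//.
rewrite innerBr inner_rot /rot conj_orthVK// inner_diag_diag.
by rewrite inner_rot /rot; case: XU => _ {2}->; rewrite conj_orthVK// inner_diag_diag innerBr.
Qed.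

Lemma lam_dir_expand H P w : symm H -> frame x (rot H) P w ->
  exists2 K : R, 0 <= K & exists2 del : R, 0 < del &
    forall t, 0 < t -> t < del -> forall H', symm H' ->
      nrm (lam (X + t *: H') - x - t *: w) <= K * t ^+ 2 + t * nrm (H' - H).
Proof.
move=> HS F; have [K K0 [del del0 HK]] := lam_expand xN (rotS HS) F.
exists K => //; exists del => // t t0 td H' HS'.
by have := HK _ t0 td _ (rotS HS'); rewrite rotB nrm_rot lam_rot.
Qed.

Lemma dlamE H P w : symm H -> frame x (rot H) P w -> dlam X H = w.
Proof.
move=> HS F; have [K K0 [del del0 HK]] := lam_dir_expand HS F.
have lim : is_dlam X H w.
  move=> e e0; have K1 : 0 < K + 1 by lra.
  exists (Num.min del (e / (K + 1))) => [|t t0].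
    by rewrite lt_min del0 divr_gt0.
  rewrite lt_min => /andP[td te]; have := HK _ t0 td _ HS.
  rewrite subrr nrm0 mulr0 addr0 => le.
  rewrite (_ : _ - w = t^-1 *: (lam (X + t *: H) - x - t *: w)); last first.
    by rewrite [RHS]scalerBr scalerA mulVf ?gt_eqF// scale1r.
  rewrite nrmZ gtr0_norm ?invr_gt0// mulrC ltr_pdivrMr//.
  apply: le_lt_trans le _; rewrite expr2 mulrA ltr_pM2r//.
  by move: te; rewrite ltr_pdivlMr//; lra.
(* [dlam] is a choice among limits, so uniqueness of the limit is needed as well. *)
apply: xget_unique => // d lim'.
apply/eqP; rewrite -subr_eq0; apply/eqP/nrm0_eq0/eqP.
rewrite eq_le nrm_ge0 andbT leNgt; apply/negP => d0.
have d2 : 0 < nrm (d - w) / 2 by rewrite divr_gt0.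
have [del1 del10 H1] := lim _ d2; have [del2 del20 H2] := lim' _ d2.
pose m := Num.min del1 del2.
have m0 : 0 < m by rewrite lt_min del10.
have [t0 tm] : 0 < m / 2 /\ m / 2 < m by split; lra.
move: tm; rewrite {2}/m lt_min => /andP[t1 t2].
have := H1 _ t0 t1; have := H2 _ t0 t2.
set a := _ *: _ => h2 h1.
have := nrm_triangle a d w; rewrite (nrm_distC d a); lra.
Qed.

(** The slope hypothesis covers both critical directions and those with second subderivative below
    [+oo]. Insert it into the subgradient inequality of [theta] at [lam (X + t *: H')] and expand
    [lam] to first order; the result is the equality case of the blockwise Fan inequality. *)
Lemma inner_le_of_slope H P w : symm H -> frame x (rot H) P w ->
  (forall e d : R, 0 < e -> 0 < d -> exists t H', [/\ 0 < t, t < d, symm H',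
     nrm (H' - H) < d & (g (X + t *: H') <= (b + t * (inner Y H + e))%:E)%E]) ->
  inner y w <= inner (diag_mx y) (rot H).
Proof.
move=> HS F slope; have [K K0 [del del0 HK]] := lam_dir_expand HS F.
rewrite -inner_rot -subr_le0; have y0 := nrm_ge0 y.
apply: (@le0_of_le_small _ _ (1 + nrm y * (K + 1))) => [|s s0].
  by rewrite addr_ge0 ?mulr_ge0 ?addr_ge0.
have d0 : 0 < Num.min s del by rewrite lt_min s0.
have [t [H' [t0]]] := slope _ _ s0 d0.
rewrite !lt_min => /andP[ts td] HS' /andP[Hs _] gle.
have [_ [_ /(_ (lam (X + t *: H')) I)]] := theta_sub.
rewrite -gX gXb -g_spectral; last exact: symm_dir.
move=> /le_trans/(_ gle); rewrite lee_fin lerD2l => le1.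
have le2 := HK _ t0 td _ HS'.
have le3 : - (nrm y * (K * t ^+ 2 + t * nrm (H' - H))) <=
    inner y (lam (X + t *: H') - x - t *: w).
  rewrite lerNl -innerNr; apply: le_trans (inner_le _ _) _.
  by rewrite nrmN ler_wpM2l.
rewrite innerBr innerZr in le3.
have le4 : nrm y * (K * t ^+ 2 + t * nrm (H' - H)) <= t * (nrm y * (K + 1) * s).
  rewrite [leRHS](_ : _ = nrm y * (t * ((K + 1) * s))); last ring.
  rewrite ler_wpM2l// expr2 mulrA -[in leLHS](mulrC t) -mulrDr ler_pM2l//.
  by have := ler_wpM2l K0 (ltW ts); have := ltW Hs; lra.
have : t * (inner y w - inner Y H) <= t * ((1 + nrm y * (K + 1)) * s) by lra.
by rewrite ler_pM2l.
Qed.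

Lemma crit_cone_slope H : crit_cone (@symm R n) g X Y H ->
  forall e d : R, 0 < e -> 0 < d -> exists t H', [/\ 0 < t, t < d, symm H',
     nrm (H' - H) < d & (g (X + t *: H') <= (b + t * (inner Y H + e))%:E)%E].
Proof.
move=> [HS dgE] e d e0 d0.
have : (subderiv (@symm R n) g X H < (inner Y H + e)%:E)%E.
  by rewrite dgE lte_fin ltrDl.
move=> /liminf_tw_lt/(_ d d0)[t [H' [t0 td HS' Hd]]].
rewrite gXb => q; exists t, H'; split=> //.
case: (g (X + t *: H')) q => [a| |]; last by rewrite leNye.
  rewrite -EFinB -EFinM lte_fin ltr_pdivrMr// => q.
  by rewrite lee_fin; lra.
by rewrite addye// gt0_mulye ?lte_fin ?invr_gt0// ltNge leey.
Qed.

Lemma second_subderiv_slope H : symm H ->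
  (second_subderiv (@symm R n) g X Y H < +oo)%E ->
  forall e d : R, 0 < e -> 0 < d -> exists t H', [/\ 0 < t, t < d, symm H',
     nrm (H' - H) < d & (g (X + t *: H') <= (b + t * (inner Y H + e))%:E)%E].
Proof.
move=> HS d2 e d e0 d0.
have [C C0 HC] : exists2 C : R, 0 <= C & (second_subderiv (@symm R n) g X Y H < C%:E)%E.
  case: (second_subderiv _ _ _ _ _) d2 => [r| |]// _; last by exists 0 => //; rewrite ltNy0.
  exists (`|r| + 1); first by rewrite addr_ge0.
  by rewrite lte_fin; have := ler_norm r; lra.
have Y0 := nrm_ge0 Y.
have D0 : 0 < nrm Y + C + 1 by lra.
(* Within [d'], the change of the linear term and the second-order term together cost at most [e]
   per unit of [t]. *)
pose d' := Num.min d (e / (nrm Y + C + 1)).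
have d'0 : 0 < d' by rewrite lt_min d0 divr_gt0.
have [t [H' [t0]]] := liminf_tw_lt HC d'0.
rewrite !lt_min => /andP[td te] HS' /andP[Hd He] q; exists t, H'; split=> //.
move: q; rewrite /dq2 gXb; case: (g (X + t *: H')) => [a| |]; last by rewrite leNye.
  rewrite -!EFinB -EFinM lte_fin ltr_pdivrMr ?mulr_gt0 ?invr_gt0 ?exprn_gt0// => q.
  rewrite lee_fin.
  have i1 : inner Y H' - inner Y H <= nrm Y * (e / (nrm Y + C + 1)).
    rewrite -innerBr; apply: le_trans (inner_le _ _) _; rewrite ler_wpM2l//; exact: ltW.
  have i2 : C * t <= C * (e / (nrm Y + C + 1)) by rewrite ler_wpM2l// ltW.
  have i3 : (nrm Y + C) * (e / (nrm Y + C + 1)) <= e.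
    rewrite mulrCA mulrA ler_pdivrMr// ler_pM2l//; lra.
  have i4 : 0 <= C * t by rewrite mulr_ge0// ltW.
  have : t * (inner Y H' + C * t / 2) <= t * (inner Y H + e).
    by rewrite ler_pM2l//; lra.
  by rewrite expr2 in q *; lra.
by rewrite !addye// gt0_mulye ?lte_fin ?half_sqr_inv_gt0// ltNge leey.
Qed.

(** The partner of [H'] is the exact eigenvalue quotient [w'], so [g] and [theta] take the same
    value and only the linear terms differ; [inner_lam_ge] bounds that difference. Dividing by
    [t ^+ 2 / 2] produces the factor 2. *)
Lemma second_subderiv_lower H P w : symm H -> frame x (rot H) P w ->
  (second_subderiv setT theta x y w + (2 * curv x y (rot H))%:E
    <= second_subderiv (@symm R n) g X Y H)%E.
Proof.
move=> HS F; have [K K0 [del del0 HK]] := lam_dir_expand HS F.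
have [K' K'0 HK'] := inner_lam_ge x yN (rotS HS).
apply: liminf_tw_transfer => d e d0 e0.
have K1 : 0 < K + 1 by lra.
have K'1 : 0 < 4 * K' + 1 by lra.
(* Keeps [w'] within [d] of [w], and the error of [inner_lam_ge], doubled by the division, at most
   [e]. *)
pose d' := Num.min (Num.min d del) (Num.min 1 (Num.min (d / (K + 1)) (e / (4 * K' + 1)))).
exists d' => [|t H' t0]; first by rewrite !lt_min d0 del0 ltr01 !divr_gt0.
rewrite /d' !lt_min => /andP[/andP[td tdel] /and3P[_ tK tK']] HS'.
move=> /andP[/andP[_ _] /and3P[H1 HK1 HK'1]].
set h := nrm (H' - H) in H1 HK1 HK'1.
have h0 : 0 <= h by exact: nrm_ge0.
pose w' := t^-1 *: (lam (X + t *: H') - x).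
have tw' : t *: w' = lam (X + t *: H') - x.
  by rewrite /w' scalerA mulfV ?gt_eqF// scale1r.
exists w'; split=> //.
  have le := HK _ t0 tdel _ HS'.
  rewrite (_ : w' - w = t^-1 *: (lam (X + t *: H') - x - t *: w)); last first.
    by rewrite [RHS]scalerBr scalerA mulVf ?gt_eqF// scale1r.
  rewrite nrmZ gtr0_norm ?invr_gt0// mulrC ltr_pdivrMr//.
  apply: le_lt_trans le _; rewrite -/h expr2.
  rewrite (_ : _ + _ = (K * t + h) * t); last ring.
  rewrite ltr_pM2r//.
  have := ler_wpM2l K0 (ltW tK); move: HK1.
  have : (K + 1) * (d / (K + 1)) = d by rewrite mulrCA divff ?mulr1// gt_eqF.
  lra.
rewrite /dq2 -gX gXb tw' [x + _]addrCA subrr addr0 -g_spectral; last exact: symm_dir.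
rewrite (quot_shift _ b (t * inner y w') (t * inner Y H') (half_sqr_inv_gt0 t0)).
rewrite leeD2l// lee_fin ler_pdivlMr ?mulr_gt0 ?invr_gt0 ?exprn_gt0//.
have := HK' _ t0 _ (rotS HS'); rewrite rotB nrm_rot -/h -lam_rot// -inner_rot.
move=> /(_ (ltW H1)) le; rewrite -innerZr tw' innerBr.
have i1 : K' * (t + h) <= e / 2.
  apply: (@le_trans _ _ (K' * (2 * (e / (4 * K' + 1))))).
    by rewrite ler_wpM2l//; lra.
  have : (4 * K' + 1) * (e / (4 * K' + 1)) = e by rewrite mulrCA divff ?mulr1// gt_eqF.
  have : 0 <= e / (4 * K' + 1) by rewrite divr_ge0// ltW.
  lra.
have := ler_wpM2l (ltW (exprn_gt0 2 t0)) i1; lra.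
Qed.

Lemma second_subderiv_upper H P w : symm H -> frame x (rot H) P w ->
  inner y w <= inner (diag_mx y) (rot H) -> parab_regular_for setT theta x y ->
  (second_subderiv setT theta x y w < +oo)%E ->
  exists (t_ : nat -> R) (H_ : nat -> 'M[R]_n),
    [/\ forall k, 0 < t_ k, t_ @ \oo --> (0 : R), forall k, symm (H_ k),
    (fun k => nrm (H_ k - H)) @ \oo --> (0 : R) &
    (fun k => dq2 g X Y (t_ k) (H_ k)) @ \oo -->
      (second_subderiv setT theta x y w + (2 * curv x y (rot H))%:E)%E] /\
  exists M : R, forall k, nrm (H_ k - H) / t_ k <= M.
Proof.
move=> HS F yw reg dfin.
have [t_ [w_ [[t0 t_0 _ w_w cvw] [M HM]]]] := reg _ I dfin.
have [P' F' Py] := critical_frame xN yN (rotS HS) F yw.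
have [K K0 HK] := frame_curve (rotS HS) F' Py.
have /choice[V HV] k : exists V, orthogonal V /\
    (nrm (V *m diag_mx (x + t_ k *: w_ k) *m V^T - diag_mx x - t_ k *: rot H)
       <= K * t_ k ^+ 2 + t_ k * nrm (w_ k - w) /\
     `|inner (diag_mx y) (V *m diag_mx (x + t_ k *: w_ k) *m V^T) - inner y x
       - t_ k * inner y (w_ k) + t_ k ^+ 2 * curv x y (rot H)|
       <= K * t_ k ^+ 3 * (1 + nrm (w_ k))).
  by have [V VO /(_ (w_ k)) HV] := HK _ (t0 k); exists V.
(* [H_ k] is chosen so that [X + t_ k *: H_ k] is a rotation of [diag_mx (x + t_ k *: w_ k)], where
   [g] equals [theta] exactly. *)
pose X_ k := V k *m diag_mx (x + t_ k *: w_ k) *m (V k)^T.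
pose G k := (t_ k)^-1 *: (X_ k - diag_mx x).
pose H_ k := U *m G k *m U^T.
have tG k : t_ k *: G k = X_ k - diag_mx x.
  by rewrite /G scalerA mulfV ?scale1r// gt_eqF.
have rotH k : rot (H_ k) = G k by rewrite /rot conj_orthVK.
have HkS k : symm (H_ k).
  apply/symm_conj/symmZ/symmB; last exact: symm_diag.
  exact/symm_conj/symm_diag.
have XHk k : g (X + t_ k *: H_ k) = theta (x + t_ k *: w_ k).
  have := conj_dir x (t_ k) (H_ k) UO; rewrite -/(rot _) rotH tG.
  case: XU => _ <- <-; rewrite addrCA subrr addr0 spectral_conj//; last exact/symm_conj/symm_diag.
  by rewrite spectral_conj_diag//; case: (HV k).
(* Besides [nrm (w_ k - w)] the error is linear in [t_ k], so the bounded rate of [w_] passes to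
   [H_]. *)
have nHk k : nrm (H_ k - H) <= K * t_ k + nrm (w_ k - w).
  rewrite -nrm_rot -rotB rotH -(@ler_pM2l _ (t_ k))// -[X in X * nrm (G k - _)](gtr0_norm (t0 k)).
  rewrite -nrmZ scalerBr tG; have [_ [+ _]] := HV k => /le_trans; apply.
  by rewrite expr2; lra.
exists t_, H_; split; last first.
  exists (K + M) => k; rewrite ler_pdivrMr// mulrDl; apply: le_trans (nHk k) _.
  by rewrite lerD2l -ler_pdivrMr.
split=> //.
  have cvu : (fun k => K * t_ k + nrm (w_ k - w)) @ \oo --> (0 : R).
    rewrite (_ : (0 : R) = K * 0 + 0); last by rewrite mulr0 addr0.
    by apply: cvgD w_w; apply: cvgM t_0; exact: cvg_cst.
  apply: (squeeze_cvgr _ (@cvg_cst _ (0 : R) _ _ _) cvu); apply: nearW => k.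
  by rewrite nrm_ge0 nHk.
(* The contribution of the two linear terms, the only difference between the quotients; it tends to
   [2 * curv x y (rot H)]. *)
pose delta k := (t_ k * inner y (w_ k) - t_ k * inner Y (H_ k)) * (2^-1 * t_ k ^+ 2)^-1.
have dqE k : dq2 g X Y (t_ k) (H_ k) = (dq2 theta x y (t_ k) (w_ k) + (delta k)%:E)%E.
  rewrite /dq2 XHk -gX gXb.
  exact: (quot_shift _ b (t_ k * inner y (w_ k)) _ (half_sqr_inv_gt0 (t0 k))).
pose u k := 2 * K * t_ k * (1 + nrm w + nrm (w_ k - w)).
have du k : `|delta k - 2 * curv x y (rot H)| <= u k.
  have [_ [_ le]] := HV k.
  have th : 0 < 2^-1 * t_ k ^+ 2 by rewrite mulr_gt0 ?invr_gt0 ?exprn_gt0.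
  rewrite -(ler_pM2r th) -[X in `|_| * X](gtr0_norm th) -normrM mulrBl /delta divfK ?gt_eqF//.
  have iG : t_ k * inner (diag_mx y) (G k) = inner (diag_mx y) (X_ k) - inner y x.
    by rewrite -innerZr tG innerBr inner_diag_diag.
  rewrite inner_rot rotH iG -normrN.
  rewrite -/(X_ k) in le.
  rewrite [X in `|X|](_ : _ = inner (diag_mx y) (X_ k) - inner y x - t_ k * inner y (w_ k) +
    t_ k ^+ 2 * curv x y (rot H)); last by field.
  apply: le_trans le _; rewrite /u.
  rewrite [leRHS](_ : _ = K * t_ k ^+ 3 * (1 + nrm w + nrm (w_ k - w))); last by field.
  have K3 : 0 <= K * t_ k ^+ 3 := mulr_ge0 K0 (exprn_ge0 3 (ltW (t0 k))).
  rewrite ler_wpM2l// -addrA lerD2l.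
  by rewrite -{1}(subrK w (w_ k)) addrC; exact: nrmD.
have cvu : u @ \oo --> (0 : R).
  rewrite (_ : (0 : R) = 2 * K * 0 * (1 + nrm w + 0)); last by rewrite mulr0 mul0r.
  apply: cvgM; first by apply: cvgM t_0; exact: cvg_cst.
  by apply: cvgD w_w; exact: cvg_cst.
have cvd : delta @ \oo --> 2 * curv x y (rot H).
  apply/cvgrPdist_lt => e e0; have := cvg0_lt cvu e0; apply: filterS => k.
  by apply: le_lt_trans; rewrite distrC.
rewrite (_ : (fun k => _) = (fun k => dq2 theta x y (t_ k) (w_ k) + (delta k)%:E)%E); last first.
  by apply/funext => k; exact: dqE.
apply: cvgeD cvw _; first exact: fin_num_adde_defl.
by apply: cvg_EFin => //; exact: nearW.
Qed.

Lemma second_subderiv_eq H P w : symm H -> frame x (rot H) P w ->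
  inner y w <= inner (diag_mx y) (rot H) -> parab_regular_for setT theta x y ->
  second_subderiv (@symm R n) g X Y H =
    (second_subderiv setT theta x y w + (2 * curv x y (rot H))%:E)%E.
Proof.
move=> HS F yw reg; have lower := second_subderiv_lower HS F.
(* When the value for [theta] is [+oo], the lower bound alone gives equality. *)
have := leey (second_subderiv setT theta x y w); rewrite le_eqVlt => /predU1P[E|fin].
  by move: lower; rewrite E addye// leye_eq => /eqP.
have [t_ [H_ [[t0 t_0 HkS H_H cv] _]]] := second_subderiv_upper HS F yw reg fin.
apply/eqP; rewrite eq_le lower andbT.
exact: liminf_tw_le_lim t0 t_0 HkS H_H cv.
Qed.

Lemma spectral_parab_regular_for : parab_regular_for setT theta x y ->
  parab_regular_for (@symm R n) g X Y.
Proof.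
move=> reg H HS d2; have [P [w F]] := frame_exists x (rotS HS).
have yw := inner_le_of_slope HS F (second_subderiv_slope HS d2).
have E := second_subderiv_eq HS F yw reg.
have fin : (second_subderiv setT theta x y w < +oo)%E.
  move: d2; rewrite E; case: (second_subderiv _ _ _ _ w) => //= r _; exact: ltry.
rewrite E; exact: second_subderiv_upper HS F yw reg fin.
Qed.

Lemma spectral_second_subderiv H : parab_regular_for setT theta x y ->
  crit_cone (@symm R n) g X Y H -> second_subderiv (@symm R n) g X Y H =
  (second_subderiv setT theta x y (dlam X H) + (2 * curv_term X Y U H)%:E)%E.
Proof.
move=> reg HK; have [HS _] := HK; have [P [w F]] := frame_exists x (rotS HS).
have yw := inner_le_of_slope HS F (crit_cone_slope HK).
by rewrite (dlamE HS F) curv_termE// (second_subderiv_eq HS F yw reg).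
Qed.

End Frame.
End PartA.
End Spectral.

Theorem theorem5p8 (R : realType) (n : nat)
  (g : 'M[R]_n -> \bar R) (theta : 'rV[R]_n -> \bar R) :
  (forall X : 'M[R]_n, symm X -> g X = theta (lam X)) ->
  (forall x : 'rV[R]_n, theta x = g (diag_mx x)) ->
  never_minfty (@symm R n) g ->
  loc_lipschitz_rel_dom (@symm R n) g -> lsc (@symm R n) g -> convex_fun (@symm R n) g ->
  forall X : 'M[R]_n, symm X ->
  (forall Y : 'M[R]_n, subdiff (@symm R n) g X Y ->
     parab_regular_for setT theta (lam X) (lam Y) ->
     parab_epi_diff setT theta (lam X) ->
     parab_regular_for (@symm R n) g X Y /\
     forall H : 'M[R]_n, crit_cone (@symm R n) g X Y H ->
     forall U : 'M[R]_n, On X U -> On Y U ->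
       second_subderiv (@symm R n) g X Y H =
       (second_subderiv setT theta (lam X) (lam Y) (dlam X H)
          + (2 * curv_term X Y U H)%:E)%E) /\
  (parab_epi_diff (@symm R n) g X -> parab_regular (@symm R n) g X ->
     parab_regular setT theta (lam X)).
Proof.
move=> gS thD _ _ _ gC X XS; split=> [Y YX reg _|_ reg v vx]; last first.
  have [U XU] := On_nonempty XS.
  exact: (theta_parab_regular_for gS thD gC XS XU vx reg).
split=> [|H HK U XU YU].
  have [U XU YU] := subdiff_On gS XS YX.
  exact: (spectral_parab_regular_for gS thD XS YX XU YU reg).
exact: (spectral_second_subderiv gS thD XS YX XU YU reg HK).
Qed.
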